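(* Let $\mathbb{F}$ be a field of characteristic $p\ge2$. Let $f,u_0,u_1\in\mathbb{F}[x_1,\ldots,x_n]$ be nonzero with $f=u_0u_1$ and $\mathrm{size}(f)+\mathrm{size}(u_0)\le s$. Then every polynomial factor of $\mathrm{rad}_p(u_1)$ has an algebraic circuit over $\overline{\mathbb{F}}$ of size $\mathrm{poly}\big(s+\deg(\mathrm{rad}_p(u_1))\big)$.
   Context: An algebraic circuit is a DAG of addition and multiplication gates with variables and field constants at the leaves; size is the number of nodes and edges; no degree bound is imposed. $\mathrm{size}(h)$ is the minimum circuit size of $h$. If $u=\prod_i u_i^{e_i}$ is the factorization of $u$ into pairwise coprime irreducible polynomials, the partial radical is $\mathrm{rad}_p(u):=\prod_{i:\,p\nmid e_i}u_i$. $\overline{\mathbb{F}}$ is the algebraic closure of $\mathbb{F}$. *)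

(* Defs.v *)
From HB Require Import structures.
From mathcomp Require Import all_boot all_order all_algebra.
From mathcomp Require Import boolp.
From mathcomp.multinomials Require Import mpoly.

Set Implicit Arguments.
Unset Strict Implicit.
Unset Printing Implicit Defensive.

Import GRing.Theory.
Local Open Scope ring_scope.

Section Circuits.
Variables (R : comNzRingType) (n : nat).

(* A DAG is presented in topological order: a circuit is the list of its nodes,
   and the internal nodes carry the positions of their children. A position may
   be repeated (parallel edges), as in a squaring gate; fan-in and fan-out are
   unbounded. *)
Inductive gate :=
  | Var of 'I_n
  | Const of R
  | Add of seq nat
  | Mul of seq nat.

Definition children (g : gate) : seq nat :=
  match g with Add js => js | Mul js => js | _ => [::] end.

Definition is_leaf (g : gate) : bool :=
  match g with Add _ => false | Mul _ => false | _ => true end.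

Definition circuit := seq gate.

Definition circuit_wf (C : circuit) : Prop :=
  forall i, (i < size C)%N -> let g := nth (Const 0) C i in
    is_leaf g || (children g != [::]) && all (fun j => j < i)%N (children g).

Definition gate_val (vs : seq {mpoly R[n]}) (g : gate) : {mpoly R[n]} :=
  match g with
  | Var i => 'X_i
  | Const c => c%:MP
  | Add js => \sum_(j <- js) vs`_j
  | Mul js => \prod_(j <- js) vs`_j
  end.

Definition circuit_vals (C : circuit) : seq {mpoly R[n]} :=
  foldl (fun vs g => rcons vs (gate_val vs g)) [::] C.

(* Any node may serve as the output. *)
Definition computes (C : circuit) (h : {mpoly R[n]}) : Prop :=
  circuit_wf C /\ h \in circuit_vals C.

Definition circuit_size (C : circuit) : nat :=
  (size C + \sum_(g <- C) size (children g))%N.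

Lemma circuit_vals_rcons C g :
  circuit_vals (rcons C g) =
  rcons (circuit_vals C) (gate_val (circuit_vals C) g).
Proof. by rewrite /circuit_vals -cats1 foldl_cat. Qed.

Lemma size_circuit_vals C : size (circuit_vals C) = size C.
Proof.
elim/last_ind: C => [//|C g IH].
by rewrite circuit_vals_rcons !size_rcons IH.
Qed.

Lemma mem_circuit_vals_cat C D h :
  h \in circuit_vals C -> h \in circuit_vals (C ++ D).
Proof.
elim/last_ind: D => [|D g IH] hC; first by rewrite cats0.
by rewrite -rcons_cat circuit_vals_rcons mem_rcons inE IH ?orbT.
Qed.

Lemma circuit_wf_rcons C g : circuit_wf C ->
  is_leaf g ||
    (children g != [::]) && all (fun j => j < size C)%N (children g) ->
  circuit_wf (rcons C g).
Proof.
move=> wfC wfg i; rewrite size_rcons ltnS leq_eqVlt => /orP[/eqP->|ltiC] /=.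
  by rewrite nth_rcons ltnn eqxx.
by rewrite nth_rcons ltiC; apply: wfC.
Qed.

Let extendable h := forall C, circuit_wf C -> exists D, computes (C ++ D) h.

Let extendable1 h g :
  is_leaf g -> (forall vs, gate_val vs g = h) -> extendable h.
Proof.
move=> gl gv C wfC; exists [:: g]; rewrite cats1; split.
  by apply: circuit_wf_rcons => //; rewrite gl.
by rewrite circuit_vals_rcons gv mem_rcons inE eqxx.
Qed.

Let extendable2 (mk : seq nat -> gate) op h1 h2 :
    (forall js, children (mk js) = js) ->
    (forall vs i j, gate_val vs (mk [:: i; j]) = op vs`_i vs`_j) ->
  extendable h1 -> extendable h2 -> extendable (op h1 h2).
Proof.
move=> chE valE e1 e2 C wfC.
have [D1 [wf1 in1]] := e1 C wfC; have [D2 [wf2 in2]] := e2 _ wf1.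
have {}in1 := mem_circuit_vals_cat D2 in1.
set C2 := (C ++ D1) ++ D2 in wf2 in1 in2.
set i1 := index h1 (circuit_vals C2); set i2 := index h2 (circuit_vals C2).
exists (D1 ++ D2 ++ [:: mk [:: i1; i2]]); rewrite 2!catA -/C2 cats1; split.
  apply: circuit_wf_rcons => //; rewrite chE /= -size_circuit_vals.
  by rewrite !index_mem in1 in2 orbT.
by rewrite circuit_vals_rcons valE !nth_index // mem_rcons inE eqxx.
Qed.

Lemma has_circuit h : exists C, computes C h.
Proof.
have eC c : extendable c%:MP by apply: (@extendable1 _ (Const c)).
have eD h1 h2 : extendable h1 -> extendable h2 -> extendable (h1 + h2).
  apply: (@extendable2 Add +%R) => // vs i j /=.
  by rewrite big_cons big_seq1.
have eM h1 h2 : extendable h1 -> extendable h2 -> extendable (h1 * h2).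
  apply: (@extendable2 Mul *%R) => // vs i j /=.
  by rewrite big_cons big_seq1.
suff eh : extendable h by have [//|C Ch] := eh [::]; exists C.
have e0 : extendable 0 by rewrite -[0]mpolyC0; apply: eC.
have e1 : extendable 1 by rewrite -[1]mpolyC1; apply: eC.
have eX i : extendable 'X_i by apply: (@extendable1 _ (Var i)).
rewrite (mpolyE h); apply: (big_ind extendable e0 eD) => m _.
rewrite -mul_mpolyC mpolyXE_id; apply: (eM _ _ (eC _)).
apply: (big_ind extendable e1 eM) => i _.
by elim: (m i) => [|k IH]; rewrite ?expr0 ?exprS //; apply: eM.
Qed.

Fact has_min_size h :
  exists m, `[< exists C, computes C h /\ circuit_size C = m >].
Proof.
by have [C Ch] := has_circuit h; exists (circuit_size C); apply/asboolP; exists C.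
Qed.

Definition poly_size (h : {mpoly R[n]}) : nat := ex_minn (has_min_size h).

End Circuits.

Section PartialRadical.
Variables (F : fieldType) (n : nat).
Implicit Types (a b d q u r : {mpoly F[n]}).

Definition total_degree u : nat := (msize u).-1.

Definition mdivides d a : Prop := exists b, a = d * b.

Definition mcoprime a b : Prop :=
  forall d, mdivides d a -> mdivides d b -> d \is a GRing.unit.

Definition mirreducible q : Prop :=
  [/\ q != 0, q \isn't a GRing.unit &
      forall a b, q = a * b -> a \is a GRing.unit \/ b \is a GRing.unit].

(* us lists the pairs (u_i, e_i); the factorization is up to a nonzero
   constant c. *)
Definition irreducible_factorization u (c : F)
    (us : seq ({mpoly F[n]} * nat)) : Prop :=
  [/\ c != 0,
      forall ue, ue \in us -> mirreducible ue.1 /\ (0 < ue.2)%N,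
      forall i j, (i < j < size us)%N ->
        mcoprime (nth (0, 0%N) us i).1 (nth (0, 0%N) us j).1 &
      u = c *: \prod_(ue <- us) ue.1 ^+ ue.2].

(* r is rad_p(u); rad_p(u) is determined by u only up to the choice of the
   irreducible factors in their classes modulo nonzero constants. *)
Definition is_partial_radical (p : nat) u r : Prop :=
  exists (c : F) us, irreducible_factorization u c us /\
    r = \prod_(ue <- us | ~~ (p %| ue.2)%N) ue.1.

End PartialRadical.

Definition is_algebraic_closure (F : fieldType) (K : closedFieldType)
    (iota : {rmorphism F -> K}) : Prop :=
  forall x : K, algebraicOver iota x.

(* Main.v *)
Require Import Defs.
From HB Require Import structures.
From mathcomp Require Import all_boot all_order all_algebra.
From mathcomp Require Import boolp zify ring.
From mathcomp Require classical_sets.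
From mathcomp.multinomials Require Import mpoly.

(* For a derivation D of F[x], the logarithmic derivative
   Df/f - Du0/u0 = Du1/u1 = sum_i e_i Du_i/u_i forgets the factors u_i with
   p | e_i, so it is a fraction N/q of degree at most deg rad_p(u1) whose value
   at a point is cheap to compute, although f and u0 may have huge degree.
   Given a factor u = u_i of rad_p(u1), D can be chosen with u not dividing Du:
   a partial derivative, or, if all partials of u vanish, a derivation of the
   field F acting on coefficients (u would otherwise be a p-th power up to a
   constant).  Then u | q, and u, q/u, N are pairwise coprime.

   On a generic line with parameter y these three become coprime univariate
   polynomials over K.  Their coefficients, as functions of the base point x of
   the line, solve the equations (Df/f - Du0/u0) u (q/u) = N at 2d+1 values of
   y, and coprimality makes the Jacobian of this system at one point injective.
   Hence the simplified Newton iteration with a constant left inverse of the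
   Jacobian gains one degree in x per step; after d steps the homogeneous
   components of degree at most d are extracted from the circuit, which gives u.
   Products of such factors are all the factors of rad_p(u1). *)

Set Implicit Arguments.
Unset Strict Implicit.
Unset Printing Implicit Defensive.

Import GRing.Theory.
Local Open Scope ring_scope.

(** * Factorial rings and the Gauss lemma *)

(** Circuits may use arbitrary constants, so the special line, the sample points, the starting
    values of the iteration and the inverse Jacobian only have to exist. Clearing denominators gives
    [a * (u * q) = N * b] with [a = u0 * D f - f * D u0] and [b = f * u0], so no division gate ever
    arises. This equation determines u, q and N only up to constant multiples, and that freedom
    would put a kernel into the Jacobian. The line removes it: the leading coefficient of u in y is
    the top-degree form of u at the direction of the line, which does not depend on x. It is
    therefore a scalar, the same holds for q, and only the lower coefficients are unknown. Whatever
    n is, at most 2d+1 unknowns remain; the 2d+1 sample values exceed the degree 2d in y of the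
    linearized equation. Coprime polynomials in several variables may have common zeros, so
    coprimality has to be shown to survive on a line. Hence the line with indeterminate coordinates
    and the Gauss lemma, which also turns irreducible factors into primes. *)

Definition rdvd (R : comNzRingType) (a b : R) : Prop := exists c, b = a * c.

Definition rprime (R : idomainType) (p : R) : Prop :=
  [/\ p != 0, p \isn't a GRing.unit &
      forall a b, rdvd p (a * b) -> rdvd p a \/ rdvd p b].

(** Factors are required to be prime rather than irreducible, so uniqueness of factorization comes
    for free and never has to be stated. *)
Definition factorial_ring (R : idomainType) : Prop :=
  forall a : R, a != 0 -> exists c s,
    [/\ c \is a GRing.unit, forall p, p \in s -> rprime p & a = c * \prod_(p <- s) p].

Section Divisibility.
Variable R : idomainType.
Implicit Types (a b c p : R).

Lemma rdvd_refl a : rdvd a a. Proof. by exists 1; rewrite mulr1. Qed.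

Lemma rdvd_trans b a c : rdvd a b -> rdvd b c -> rdvd a c.
Proof. by move=> [x ->] [y ->]; exists (x * y); rewrite mulrA. Qed.

Lemma rdvd_mulr a b c : rdvd a b -> rdvd a (b * c).
Proof. by move=> [x ->]; exists (x * c); rewrite mulrA. Qed.

Lemma rdvd_mull a b c : rdvd a c -> rdvd a (b * c).
Proof. by rewrite mulrC; apply: rdvd_mulr. Qed.

Lemma rdvdD a b c : rdvd a b -> rdvd a c -> rdvd a (b + c).
Proof. by move=> [x ->] [y ->]; exists (x + y); rewrite mulrDr. Qed.

Lemma rdvdB a b c : rdvd a b -> rdvd a c -> rdvd a (b - c).
Proof. by move=> [x ->] [y ->]; exists (x - y); rewrite mulrBr. Qed.

Lemma rdvd_unit a b : rdvd a b -> b \is a GRing.unit -> a \is a GRing.unit.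
Proof. by move=> [x ->]; rewrite unitrM => /andP[]. Qed.

Lemma unit_rdvd a b : a \is a GRing.unit -> rdvd a b.
Proof. by move=> ua; exists (a^-1 * b); rewrite mulVKr. Qed.

Lemma rprime_dvd_prod p s :
  rprime p -> rdvd p (\prod_(q <- s) q) -> exists2 q, q \in s & rdvd p q.
Proof.
move=> pp; elim: s => [|q s IH].
  rewrite big_nil => /rdvd_unit /(_ (unitr1 _)) up.
  by case: pp => _ /negP.
rewrite big_cons; case: (pp) => _ _ pr /pr[]; first by exists q; rewrite ?mem_head.
by case/IH => r rs pr'; exists r => //; rewrite inE rs orbT.
Qed.

Lemma rprime_associate p q : rprime p -> rprime q -> rdvd p q ->
  exists2 c, c \is a GRing.unit & q = p * c.
Proof.
move=> pp [q0 uq qp] [c qE]; exists c => //.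
have [|[x pE]|[x cE]] := qp p c; first by rewrite -qE; apply: rdvd_refl.
  move: q0 qE; rewrite pE => q0 /eqP.
  rewrite -mulrA -{1}[q]mulr1 (inj_eq (mulfI q0)) eq_sym => /eqP.
  by rewrite mulrC => /(congr1 (fun y => y \is a GRing.unit)); rewrite unitr1 unitrM => /andP[].
move: qE; rewrite cE mulrCA => /eqP; rewrite -{1}[q]mulr1 (inj_eq (mulfI q0)) => /eqP E.
by case: pp => _ /negP[]; apply: (@rdvd_unit _ 1); rewrite ?unitr1 //; exists x.
Qed.

Lemma rprime_irreducible p a b : rprime p -> p = a * b ->
  a \is a GRing.unit \/ b \is a GRing.unit.
Proof.
move=> [p0 up pp] pE; have [|[x aE]|[x bE]] := pp a b.
- by rewrite -pE; apply: rdvd_refl.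
- right; move: pE; rewrite aE -mulrA -{1}[p]mulr1 => /(mulfI p0) E.
  by apply: (@rdvd_unit _ 1); rewrite ?unitr1 //; exists x; rewrite mulrC.
- left; move: pE; rewrite bE mulrCA -{1}[p]mulr1 => /(mulfI p0) E.
  by apply: (@rdvd_unit _ 1); rewrite ?unitr1 //; exists x.
Qed.

Lemma rprime_mul_unit p c : c \is a GRing.unit -> rprime p -> rprime (c * p).
Proof.
move=> uc [p0 up pp]; split.
- by rewrite mulf_neq0 // (memPn _ c uc) // unitr0.
- by rewrite unitrMr.
- have E x : rdvd (c * p) x <-> rdvd p x.
    split=> [[y ->]|[y ->]]; first by exists (c * y); rewrite mulrCA mulrA.
    by exists (c^-1 * y); rewrite mulrACA divrr // mul1r.
  by move=> a b /E/pp[]/E; [left|right].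
Qed.

(** The bridge from the irreducible factors of the theorem to primes: a prime factorization of an
    irreducible element contains exactly one prime. *)
Lemma factorial_irreducible_prime p : factorial_ring R ->
  p != 0 -> p \isn't a GRing.unit ->
  (forall a b, p = a * b -> a \is a GRing.unit \/ b \is a GRing.unit) -> rprime p.
Proof.
move=> fR p0 up irr; have [c [[|q s] [uc ps pE]]] := fR p p0.
  by move: up; rewrite pE big_nil mulr1 uc.
move: pE; rewrite big_cons mulrA => pE.
have pq : rprime q by apply: ps; rewrite mem_head.
have ncq : c * q \isn't a GRing.unit by case: pq => _ uq _; rewrite unitrMr.
case: (irr _ _ pE) => [|us]; first by move/negP: ncq.
rewrite pE mulrC; apply: rprime_mul_unit => //; exact: rprime_mul_unit.
Qed.

End Divisibility.

Lemma factorial_iso (R S : idomainType) (f : {rmorphism R -> S}) (g : {rmorphism S -> R}) :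
  cancel f g -> cancel g f -> factorial_ring S -> factorial_ring R.
Proof.
move=> fK gK fS a a0.
have [|c [s [uc ps E]]] := fS (f a); first by rewrite -(rmorph0 f) (inj_eq (can_inj fK)).
exists (g c), (map g s); split.
- exact: rmorph_unit.
- move=> _ /mapP[q /ps [q0 uq pq] ->]; split.
  + by rewrite -(rmorph0 g) (inj_eq (can_inj gK)).
  + by apply: contra uq => /(rmorph_unit f); rewrite gK.
  + have dE x : rdvd (g q) x <-> rdvd q (f x).
      split=> [[y ->]|[y E']]; first by exists (f y); rewrite rmorphM gK.
      by exists (g y); rewrite -rmorphM -E' fK.
    by move=> x y /dE; rewrite rmorphM => /pq[]/dE; [left|right].
- by rewrite big_map -rmorph_prod -rmorphM -E fK.
Qed.

Lemma factorial_field (F : fieldType) : factorial_ring F.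
Proof.
move=> a a0; exists a, [::]; split => //; first by rewrite unitfE.
by rewrite big_nil mulr1.
Qed.

Section GaussLemma.
Variable R : idomainType.
Hypothesis facR : factorial_ring R.
Implicit Types (a b c p : R) (A B P W : {poly R}).

Lemma rdvd_polyC p A : rdvd p%:P A <-> forall i, rdvd p A`_i.
Proof.
split=> [[B ->] i|H]; first by exists B`_i; rewrite coefCM.
have [f fE] := choice H.
exists (\poly_(i < size A) f i); apply/polyP => i; rewrite coefCM coef_poly.
by case: ltnP => h; [rewrite fE | rewrite nth_default // mulr0].
Qed.

Lemma rprime_polyC p : rprime p -> rprime p%:P.
Proof.
move=> [p0 up pp]; split; first by rewrite polyC_eq0.
  by apply: contra up; rewrite poly_unitE coefC => /andP[].
move=> A B; have [k] := ubnP (size A + size B); elim: k A B => // k IH A B leAB dAB.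
have [A0|A0] := eqVneq A 0; first by left; exists 0; rewrite mulr0.
have [B0|B0] := eqVneq B 0; first by right; exists 0; rewrite mulr0.
have dlow (X : {poly R}) : X != 0 -> rdvd p (lead_coef X) ->
    exists Y : {poly R}, [/\ (size (X - p%:P * Y)%R < size X)%N & rdvd p%:P (X - p%:P * Y) <-> rdvd p%:P X].
  move=> X0 [y yE]; exists (y *: 'X^((size X).-1)); split.
    rewrite -mul_polyC mulrA -polyCM -yE mul_polyC.
    apply: (@leq_ltn_trans (size X).-1); last by rewrite prednK // lt0n size_poly_eq0.
    apply/leq_sizeP => j lej; rewrite coefB coefZ coefXn.
    move: lej; rewrite leq_eqVlt => /orP[/eqP<-|ltj].
      by rewrite eqxx mulr1 subrr.
    rewrite gtn_eqF // mulr0 subr0 nth_default //.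
    by move: ltj; case: (size X).
  split=> h; last by apply: rdvdB => //; apply: rdvd_mulr; apply: rdvd_refl.
  by rewrite -[X](subrK (p%:P * (y *: 'X^((size X).-1)))); apply: rdvdD => //; apply: rdvd_mulr; apply: rdvd_refl.
have : rdvd p (lead_coef A * lead_coef B).
  by rewrite -lead_coefM; move/rdvd_polyC: dAB; apply.
case/pp=> /dlow[] // Y [ltY EY].
- have [|||] := IH (A - p%:P * Y) B; last by right.
  + by rewrite -ltnS; apply: leq_trans leAB; rewrite ltnS ltn_add2r.
  + rewrite mulrBl; apply: rdvdB => //; rewrite -mulrA; apply: rdvd_mulr; exact: rdvd_refl.
  + by move/EY; left.
- have [|||] := IH A (B - p%:P * Y); last by move/EY; right.
  + by rewrite -ltnS; apply: leq_trans leAB; rewrite ltnS ltn_add2l.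
  + rewrite mulrBr; apply: rdvdB => //; rewrite mulrCA; apply: rdvd_mulr; exact: rdvd_refl.
  + by left.
Qed.

(** The usual notion of content one, phrased so that no gcd of coefficients is needed. *)
Definition primitive P : Prop := forall p, rprime p -> ~ rdvd p%:P P.

(** Prime constants are divided out one at a time. This stops because each of them is, up to a unit,
    one of the finitely many prime factors of the leading coefficient and uses it up. *)
Lemma primitive_part P : P != 0 -> exists c P', primitive P' /\ P = c *: P'.
Proof.
move=> P0; have lP0 : lead_coef P != 0 by rewrite lead_coef_eq0.
have [e [s [ue ps]]] := facR lP0.
have [k] := ubnP (size s); elim: k e s ps ue P P0 {lP0} => // k IH e s ps ue P P0 ltsk lE.
have [[p [pp [P1 PE]]]|np] := pselect (exists p, rprime p /\ rdvd p%:P P); last first.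
  by exists 1, P; rewrite scale1r; split=> // p pp dp; apply: np; exists p.
have lE1 : lead_coef P = p * lead_coef P1 by rewrite PE lead_coefM lead_coefC.
have P10 : P1 != 0 by apply: contraNneq P0 => P10; rewrite PE P10 mulr0.
have [q qs [u uu qE]] : exists2 q, q \in s & exists2 c, c \is a GRing.unit & q = p * c.
  have [|q qs dq] := @rprime_dvd_prod _ p s pp.
    by exists (e^-1 * lead_coef P1); rewrite mulrCA -lE1 lE mulKr.
  by exists q => //; apply: rprime_associate => //; apply: ps.
have [p0 _ _] := pp.
have [|||||c [P' [pP' P1E]]] := IH (e * u) (rem q s) _ _ P1.
- by move=> r /mem_rem/ps.
- by rewrite unitrM ue.
- by [].
- by rewrite size_rem //; case: (s) qs ltsk.
- apply: (mulfI p0); rewrite -lE1 lE (perm_big _ (perm_to_rem qs)) big_cons qE.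
  by rewrite !mulrA; congr (_ * _); rewrite [e * p]mulrC.
by exists (p * c), P'; split=> //; rewrite PE P1E mul_polyC scalerA.
Qed.

(** Each prime factor of [c] divides [P * W] but not the primitive [P], so by Gauss it divides [W]
    and can be cancelled. *)
Lemma primitive_cancel P A W c :
  primitive P -> c != 0 -> c *: A = P * W -> rdvd P A.
Proof.
move=> pP c0; have [e [s [ue ps ->]]] := facR c0.
elim: s ps W A {c0} => [|p s IH] ps W A.
  rewrite big_nil mulr1 => E; exists (e^-1 *: W).
  by rewrite -scalerAr -E scalerA mulVr // scale1r.
have pp : rprime p by apply: ps; rewrite mem_head.
rewrite big_cons mulrCA -scalerA -mul_polyC => E.
have [_ _ ppC] := rprime_polyC pp; case: (ppC P W).
- by rewrite -E; apply: rdvd_mulr; apply: rdvd_refl.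
- by move/(pP p pp).
case=> W' WE; apply: (IH _ W') => [q qs|]; first by apply: ps; rewrite inE qs orbT.
by apply: (@mulfI _ p%:P); rewrite ?polyC_eq0; [case: pp|rewrite E WE mulrCA].
Qed.

(** [gcdp] and [Bezoutp] hold up to scalars of [R]. If the gcd is nonconstant, its primitive part is
    a true common divisor by [primitive_cancel]; if it is constant, the scalars are absorbed into
    [c]. *)
Lemma poly_bezout A B : A != 0 ->
  (exists D : {poly R}, [/\ (1 < size D)%N, rdvd D A & rdvd D B]) \/
  exists S T c, c != 0 /\ S * A + T * B = c%:P.
Proof.
move=> A0; set G := gcdp A B.
have G0 : G != 0 by rewrite gcdp_eq0 negb_and A0.
have [sG|sG] := ltnP 1 (size G).
  left; have [c [D [pD GE]]] := primitive_part G0.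
  have c0 : c != 0 by apply: contraNneq G0 => c0; rewrite GE c0 scale0r.
  exists D; split; first by rewrite -(size_scale _ c0) -GE.
  - have /Pdiv.WeakIdomain.dvdpP[[a Q] /= a0 E] := dvdp_gcdl A B.
    apply: (primitive_cancel (c := a) (W := c *: Q)) => //.
    by rewrite E -/G GE -scalerAr -scalerAr mulrC.
  - have /Pdiv.WeakIdomain.dvdpP[[a Q] /= a0 E] := dvdp_gcdr A B.
    apply: (primitive_cancel (c := a) (W := c *: Q)) => //.
    by rewrite E -/G GE -scalerAr -scalerAr mulrC.
right; have [[S T] /= /eqpP[[a b] /= /andP[a0 b0] E]] := Bezoutp A B.
have [g gE] : exists g, G = g%:P by exists G`_0; apply: size1_polyC.
exists (a *: S), (a *: T), (b * g); split.
  by rewrite mulf_neq0 // -polyC_eq0 -gE.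
by rewrite -!scalerAl -scalerDr E -/G gE polyCM mul_polyC.
Qed.

Lemma primitive_size1_unit P : primitive P -> size P = 1%N -> P \is a GRing.unit.
Proof.
move=> pP /eqP/size_poly1P[c c0 PE]; move: pP; rewrite PE => pP.
have [e [[|p s] [ue ps cE]]] := facR c0.
  by rewrite cE big_nil mulr1 rmorph_unit.
case: (pP p); first by apply: ps; rewrite mem_head.
by exists (e * \prod_(q <- s) q)%:P; rewrite -polyCM cE big_cons mulrCA.
Qed.

(* A primitive polynomial with no factorization into polynomials of smaller
   degree is prime: Bezout over the fraction field, then cancel constants. *)
Lemma primitive_rprime P : primitive P -> (1 < size P)%N ->
  (forall A B, P = A * B -> (size A <= 1)%N \/ (size B <= 1)%N) -> rprime P.
Proof.
move=> pP sP irr; have P0 : P != 0 by rewrite -size_poly_gt0 ltnW.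
split=> //; first by rewrite poly_unitE gtn_eqF.
move=> A B [W WE]; case: (poly_bezout A P0) => [[D [sD [Q PE] dA]]|[S [T [c [c0 E]]]]].
  left; have sQ : (size Q <= 1)%N by case: (irr _ _ PE) => //; rewrite leqNgt sD.
  have pQ : primitive Q.
    by move=> p pp dp; apply: (pP p pp); rewrite PE; apply: rdvd_mull.
  have Q0 : Q != 0 by apply: contraNneq P0 => Q0; rewrite PE Q0 mulr0.
  have uQ : Q \is a GRing.unit.
    by apply: primitive_size1_unit => //; apply/eqP; rewrite eqn_leq sQ size_poly_gt0.
  apply: rdvd_trans dA; exists Q^-1; by rewrite PE mulrK.
right; apply: (primitive_cancel (c := c) (W := S * B + T * W)) => //.
rewrite -mul_polyC -E mulrDl mulrDr; congr (_ + _); first by rewrite [S * P]mulrC mulrA.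
by rewrite -mulrA WE mulrCA.
Qed.

(** Content and primitive part are factored separately. The primitive part is split by degree until
    every piece is a unit or has no two nonconstant factors, hence is prime. *)
Theorem factorial_poly : factorial_ring {poly R}.
Proof.
have fC c : c != 0 -> exists e s, [/\ e \is a GRing.unit, forall P, P \in s -> rprime P &
    c%:P = e * \prod_(P <- s) P].
  move=> c0; have [e [s [ue ps ->]]] := facR c0.
  exists e%:P, (map polyC s); split; first exact: rmorph_unit.
    by move=> _ /mapP[p /ps pp ->]; apply: rprime_polyC.
  by rewrite polyCM big_map rmorph_prod.
have fM (A B : {poly R}) : (exists e s, [/\ e \is a GRing.unit, forall P, P \in s -> rprime P &
    A = e * \prod_(P <- s) P]) -> (exists e s, [/\ e \is a GRing.unit, forall P, P \in s -> rprime P &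
    B = e * \prod_(P <- s) P]) -> (exists e s, [/\ e \is a GRing.unit, forall P, P \in s -> rprime P &
    A * B = e * \prod_(P <- s) P]).
  move=> [e [s [ue ps ->]]] [e' [s' [ue' ps' ->]]].
  exists (e * e'), (s ++ s'); split; first by rewrite unitrM ue.
    by move=> P; rewrite mem_cat => /orP[/ps|/ps'].
  by rewrite big_cat /= mulrACA.
move=> P; have [k] := ubnP (size P); elim: k P => // k IH P ltPk P0.
have [c [P' [pP' PE]]] := primitive_part P0.
have c0 : c != 0 by apply: contraNneq P0 => c0; rewrite PE c0 scale0r.
have P'0 : P' != 0 by apply: contraNneq P0 => P'0; rewrite PE P'0 scaler0.
rewrite PE -mul_polyC; apply: (fM _ _ (fC _ c0)).
have [sP'|sP'] := leqP (size P') 1.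
  exists P', [::]; split=> //; last by rewrite big_nil mulr1.
  by apply: primitive_size1_unit => //; apply/eqP; rewrite eqn_leq sP' size_poly_gt0.
have [[A [B [P'E sA sB]]]|nAB] := pselect (exists A B : {poly R}, [/\ P' = A * B, (1 < size A)%N & (1 < size B)%N]).
  have A0 : A != 0 by apply: contraNneq P'0 => A0; rewrite P'E A0 mul0r.
  have B0 : B != 0 by apply: contraNneq P'0 => B0; rewrite P'E B0 mulr0.
  have sP : (size P = (size A + size B).-1)%N by rewrite PE size_scale // P'E size_mul.
  rewrite P'E; apply: fM; apply: IH => //; rewrite -ltnS; apply: leq_trans ltPk; rewrite ltnS sP.
    by move: sB; case: (size B) => [|[|m]] // _; rewrite !addnS /= ltnS leq_addr.
  by move: sA; case: (size A) => [|[|m]] // _; rewrite !addSn /= ltnS leq_addl.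
exists 1, [:: P']; split; [exact: unitr1| | by rewrite big_seq1 mul1r].
move=> Q; rewrite inE => /eqP->; apply: primitive_rprime => // A B P'E.
have [|sA] := leqP (size A) 1; first by left.
have [|sB] := leqP (size B) 1; first by right.
by case: nAB; exists A, B.
Qed.

End GaussLemma.

(** * Multivariate polynomials *)

(** Uniqueness in the universal property of polynomial rings; most identities between substitutions,
    evaluations and translations below reduce to it. *)
Lemma mpoly_rmorph_eq (R : comNzRingType) (S : comNzRingType) n
    (f g : {rmorphism {mpoly R[n]} -> S}) :
  (forall c, f c%:MP = g c%:MP) -> (forall i, f 'X_i = g 'X_i) -> f =1 g.
Proof.
move=> fgC fgX p; rewrite [p]mpolyE !rmorph_sum; apply: eq_bigr => m _.
rewrite -mul_mpolyC !rmorphM /= fgC mpolyXE_id !rmorph_prod; congr (_ * _).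
by apply: eq_bigr => i _; rewrite !rmorphXn /= fgX.
Qed.

Lemma poly_rmorph_eq (R S : comNzRingType) (f g : {rmorphism {poly R} -> S}) :
  (forall c, f c%:P = g c%:P) -> f 'X = g 'X -> f =1 g.
Proof.
move=> fgC fgX p; rewrite -[p]coefK poly_def !rmorph_sum; apply: eq_bigr => i _.
by rewrite -mul_polyC !rmorphM /= fgC !rmorphXn /= fgX.
Qed.

Lemma mmapU (R S : comNzRingType) n (f : {rmorphism R -> S}) (h : 'I_n -> S) i :
  mmap f h 'X_i = h i.
Proof. by rewrite mmapX mmap1U. Qed.

Lemma rmorph_mmap (R S T : comNzRingType) n (g : {rmorphism S -> T})
    (f : {rmorphism R -> S}) (h : 'I_n -> S) p :
  g (mmap f h p) = mmap (g \o f) (g \o h) p.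
Proof.
apply: (@mpoly_rmorph_eq R T n (g \o mmap f h) (mmap (g \o f) (g \o h))) => [c|i] /=.
  by rewrite !mmapC.
by rewrite !mmapU.
Qed.

Lemma eq_mmap (R S : comNzRingType) n (f g : {rmorphism R -> S}) (h k : 'I_n -> S) :
  f =1 g -> h =1 k -> mmap f h =1 mmap g k.
Proof.
move=> fg hk p; apply: (@mpoly_rmorph_eq _ _ _ (mmap f h) (mmap g k)) => [c|i] /=; first by rewrite !mmapC; apply: fg.
by rewrite !mmapU hk.
Qed.

Section LastVariable.
Variables (R : idomainType) (n : nat).

(** Half of the isomorphism along which factoriality and non-vanishing climb by induction on the
    number of variables. *)
Definition split_last : {mpoly R[n.+1]} -> {poly {mpoly R[n]}} :=
  mmap (polyC \o @mpolyC n R)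
    (fun i => if unlift ord_max i is Some j then ('X_j)%:P else 'X).

HB.instance Definition _ := GRing.RMorphism.on split_last.

Definition join_last : {poly {mpoly R[n]}} -> {mpoly R[n.+1]} :=
  horner_eval 'X_ord_max \o
  map_poly (mmap (@mpolyC n.+1 R) (fun j : 'I_n => 'X_(lift ord_max j))).

HB.instance Definition _ := GRing.RMorphism.on join_last.

Lemma split_lastC c : split_last c%:MP = (c%:MP)%:P.
Proof. by rewrite /split_last mmapC. Qed.

Lemma split_lastX i :
  split_last 'X_i = if unlift ord_max i is Some j then ('X_j)%:P else 'X.
Proof. by rewrite /split_last mmapU. Qed.

Lemma join_lastC c : join_last c%:P = mmap (@mpolyC n.+1 R) (fun j : 'I_n => 'X_(lift ord_max j)) c.
Proof. by rewrite /join_last /= map_polyC /horner_eval hornerC. Qed.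

Lemma join_lastX : join_last 'X = 'X_ord_max.
Proof. by rewrite /join_last /= map_polyX /horner_eval hornerX. Qed.

Lemma split_lastK : cancel split_last join_last.
Proof.
apply: (@mpoly_rmorph_eq _ _ _ (join_last \o split_last) idfun) => [c|i] /=.
  by rewrite split_lastC join_lastC mmapC.
by rewrite split_lastX; case: unliftP => [j ->|->]; rewrite ?join_lastC ?mmapU ?join_lastX.
Qed.

Lemma join_lastK : cancel join_last split_last.
Proof.
apply: (@poly_rmorph_eq _ _ (split_last \o join_last) idfun) => [c|] /=.
  rewrite join_lastC.
  apply: (@mpoly_rmorph_eq _ _ _ (split_last \o mmap (@mpolyC n.+1 R) _) polyC) => [d|i] /=.
    by rewrite mmapC split_lastC.
  by rewrite mmapU split_lastX liftK.
by rewrite join_lastX split_lastX unlift_none.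
Qed.

End LastVariable.

Lemma factorial_mpoly (R : idomainType) n :
  factorial_ring R -> factorial_ring {mpoly R[n]}.
Proof.
move=> fR; elim: n => [|n IH].
  apply: (@factorial_iso _ R (@mcoeff 0 R 0%MM) (@mpolyC 0 R)) => //; first exact: mpolyKC.
  by move=> c; apply: mpolyCK.
apply: factorial_iso (factorial_poly IH); [exact: split_lastK|exact: join_lastK].
Qed.

(** * Points of non-vanishing over an algebraically closed field *)

Section NonVanishing.
Variable K : closedFieldType.

(** Euclid's trick: a root of 1 plus a product vanishing on [s] cannot lie in [s]. The factor ['X]
    keeps the polynomial nonconstant when [s] is empty. *)
Lemma closed_field_fresh (s : seq K) : exists x, x \notin s.
Proof.
pose p := 'X * \prod_(z <- s) ('X - z%:P) + 1.
have /closed_rootP[x rx] : size p != 1%N.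
  rewrite /p size_polyDl size_mul ?polyX_eq0 ?monic_neq0 ?monic_prod_XsubC //.
    by rewrite size_polyX size_prod_XsubC.
  by rewrite size_polyX size_prod_XsubC size_poly1.
exists x; apply/negP => xs; move: rx; rewrite /root /p !hornerE.
by rewrite (eqP (_ : root (\prod_(z <- s) ('X - z%:P)) x)) ?root_prod_XsubC // mulr0 add0r oner_eq0.
Qed.

Lemma poly_nonroot (p : {poly K}) (s : seq K) :
  p != 0 -> exists2 x, x \notin s & p.[x] != 0.
Proof.
move=> p0; have [r pE] := closed_field_poly_normal p.
have [x] := closed_field_fresh (s ++ r); rewrite mem_cat negb_or => /andP[xs xr].
exists x => //; rewrite pE hornerZ mulf_neq0 ?lead_coef_eq0 //.
by rewrite -rootE root_prod_XsubC.
Qed.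

Lemma poly_nonroots (p : {poly K}) m : p != 0 ->
  exists y : 'I_m -> K, injective y /\ forall i, p.[y i] != 0.
Proof.
move=> p0; suff [s [us sz ps]] : exists s : seq K, [/\ uniq s, size s = m & forall x, x \in s -> p.[x] != 0].
  exists (fun i => nth 0 s i); split=> [i j E|i].
    by apply/val_inj/eqP; rewrite -(nth_uniq 0 _ _ us) ?sz ?ltn_ord // E.
  by apply: ps; rewrite mem_nth // sz.
elim: m => [|m [s [us sz ps]]]; first by exists [::].
have [x xs px] := poly_nonroot s p0.
exists (x :: s); split=> [||z]; rewrite /= ?xs ?us ?sz //.
by rewrite inE => /orP[/eqP->|/ps].
Qed.

(** A point where the leading coefficient in the last variable survives leaves a nonzero univariate
    polynomial. *)
Lemma mpoly_nonroot n (p : {mpoly K[n]}) : p != 0 -> exists v, p.@[v] != 0.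
Proof.
elim: n p => [|n IH] p p0.
  exists (fun=> 0); have pE := esym (mpolyKC p).
  by rewrite pE mevalC -(mpolyC_eq0 0) -pE.
have : split_last p != 0 by rewrite -(rmorph0 (@split_last K n)) (inj_eq (can_inj (@split_lastK _ _))).
rewrite -lead_coef_eq0 => /IH[v lv].
have [|x _ px] := @poly_nonroot (map_poly (meval v) (split_last p)) [::].
  apply: contraNneq lv => /polyP/(_ (size (split_last p)).-1).
  by rewrite coef_map coef0 => /= ->.
exists (fun i => if unlift ord_max i is Some j then v j else x).
suff -> : p.@[fun i => if unlift ord_max i is Some j then v j else x]
   = (map_poly (meval v) (split_last p)).[x] by [].
apply: (@mpoly_rmorph_eq _ _ _ (meval _)
   (horner_eval x \o (map_poly (meval v) \o @split_last K n))) => [c|i] /=.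
  by rewrite mevalC split_lastC map_polyC /= mevalC /horner_eval hornerC.
rewrite mevalXU split_lastX; case: unliftP => [j _|_].
  by rewrite map_polyC /= mevalXU /horner_eval hornerC.
by rewrite map_polyX /horner_eval hornerX.
Qed.

End NonVanishing.

(** * Generic lines *)

Section Line.
Variables (F R : comNzRingType) (n : nat) (j : {rmorphism F -> R}).
Implicit Types (A B : 'I_n -> R) (p : {mpoly F[n]}).

Definition line A B : {mpoly F[n]} -> {poly R} :=
  mmap (polyC \o j) (fun i => (A i)%:P + (B i)%:P * 'X).

HB.instance Definition _ A B := GRing.RMorphism.on (line A B).

Lemma lineC A B c : line A B c%:MP = (j c)%:P.
Proof. by rewrite /line mmapC. Qed.

Lemma lineX A B i : line A B 'X_i = (A i)%:P + (B i)%:P * 'X.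
Proof. by rewrite /line mmapU. Qed.

Lemma horner_line A B p x : (line A B p).[x] = mmap j (fun i => A i + B i * x) p.
Proof.
apply: (@mpoly_rmorph_eq _ _ _ (horner_eval x \o line A B) (mmap j _)) => [c|i] /=.
  by rewrite lineC mmapC /horner_eval hornerC.
by rewrite lineX mmapU /horner_eval !hornerE.
Qed.

Lemma size_coef_line_monomial A B (m : 'X_{1..n}) :
  let P := mmap1 (fun i => (A i)%:P + (B i)%:P * 'X) m in
  (size P <= (mdeg m).+1)%N /\ P`_(mdeg m) = mmap1 B m.
Proof.
rewrite /mmap1 mdegE /=.
elim: (index_enum 'I_n) => [|i s [IHs IHc]]; first by rewrite !big_nil size_poly1 coefC.
have step (P Q : {poly R}) k l : (size P <= k.+1)%N -> (size Q <= l.+1)%N ->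
    (size (P * Q)%R <= (k + l).+1)%N /\ (P * Q)`_(k + l) = P`_k * Q`_l.
  move=> sP sQ; split.
    apply: leq_trans (size_polyMleq _ _) _.
    by lia.
  rewrite coefM (bigD1 (inord k)) //= inordK ?ltnS ?leq_addr // addKn big1 ?addr0 // => i' ni.
  have [lt|lt|E] := ltngtP i' k.
  - rewrite [Q`_ _]nth_default ?mulr0 //; apply: leq_trans sQ _; rewrite ltn_subRL ltn_add2r; exact: lt.
  - by rewrite [P`_ _]nth_default ?mul0r //; apply: leq_trans sP _.
  - by case/eqP: ni; apply: val_inj; rewrite /= inordK ?ltnS ?leq_addr.
have stepX : forall k, (size (((A i)%:P + (B i)%:P * 'X) ^+ k)%R <= k.+1)%N /\
    (((A i)%:P + (B i)%:P * 'X) ^+ k)`_k = B i ^+ k.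
  elim=> [|k [s1 c1]]; first by rewrite !expr0 size_poly1 coefC.
  rewrite !exprS; have [|s2 c2] := step ((A i)%:P + (B i)%:P * 'X) _ 1%N k _ s1.
    apply: leq_trans (size_polyD _ _) _; rewrite geq_max size_polyC.
    apply/andP; split; first by case: eqP.
    by apply: leq_trans (size_polyMleq _ _) _; rewrite size_polyX size_polyC; case: eqP.
  by move: s2 c2; rewrite !add1n => s2 ->; split=> //; rewrite c1 coefD coefC coefCM coefX /= add0r mulr1.
rewrite !big_cons; have [sX cX] := stepX (m i).
by have [s2 ->] := step _ _ _ _ sX IHs; split=> //; rewrite cX IHc.
Qed.

Lemma size_line A B p : (size (line A B p) <= msize p)%N.
Proof.
rewrite /line /mmap big_seq; apply: (big_ind (fun P : {poly R} => size P <= msize p)%N).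
- by rewrite size_poly0.
- by move=> P Q sP sQ; apply: leq_trans (size_polyD _ _) _; rewrite geq_max sP.
move=> m mp; have [sm _] := size_coef_line_monomial A B m.
rewrite /= mul_polyC; apply: leq_trans (size_scale_leq _ _) (leq_trans sm _).
exact: msize_mdeg_lt.
Qed.

Definition top_form k p : {mpoly F[n]} :=
  \sum_(m <- msupp p | mdeg m == k) p@_m *: 'X_[m].

(** The base point [A] disappears from the top coefficient. This later makes the leading
    coefficients scalars instead of unknowns. *)
Lemma coef_line_top A B k p : (msize p <= k.+1)%N ->
  (line A B p)`_k = mmap j B (top_form k p).
Proof.
move=> sp; rewrite /top_form rmorph_sum /= /line /mmap coef_sum.
rewrite [RHS]big_mkcond !big_seq; apply: eq_bigr => m mp.
have := msize_mdeg_lt mp => /leq_trans /(_ sp).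
have [sm cm] := size_coef_line_monomial A B m.
rewrite ltnS leq_eqVlt /= coefCM => /orP[/eqP E|lt].
  by rewrite -E eqxx -/(mmap j B _) mmapZ mmapX cm.
by rewrite ltn_eqF // nth_default ?mulr0 //; apply: leq_trans sm lt.
Qed.

Lemma mcoeff_top_form k p m : mdeg m = k -> (top_form k p)@_m = p@_m.
Proof.
move=> mk; rewrite /top_form [X in _ = X@_m]mpolyE !raddf_sum /= big_mkcond /=.
apply: eq_bigr => m' _; case: eqP => // ne; rewrite mcoeffZ mcoeffX.
by case: eqP => [E|]; [case: ne; rewrite E | rewrite mulr0].
Qed.

End Line.

Lemma map_line (F R S : comNzRingType) n (j : {rmorphism F -> R}) (f : {rmorphism R -> S})
    (A B : 'I_n -> R) p :
  map_poly f (line j A B p) = line (f \o j) (f \o A) (f \o B) p.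
Proof.
apply: (@mpoly_rmorph_eq _ _ _ (map_poly f \o line j A B) (line _ _ _)) => [c|i] /=.
  by rewrite !lineC map_polyC.
by rewrite !lineX rmorphD rmorphM /= !map_polyC /= map_polyX.
Qed.

Lemma top_form_neq0 (F : comNzRingType) n (p : {mpoly F[n]}) :
  p != 0 -> top_form (msize p).-1 p != 0.
Proof.
move=> p0; apply: contraTneq (mlead_supp p0) => t0.
have E : mdeg (mlead p) = (msize p).-1 by rewrite -mlead_deg.
by rewrite mcoeff_msupp -(mcoeff_top_form _ E) t0 mcoeff0 eqxx.
Qed.

(** * Coprimality on a generic line *)

Section FractionCoprime.
Variable R : idomainType.
Implicit Types (P Q : {poly R}).

(* Coprimality over the fraction field of R. *)
Definition bezout P Q : Prop := exists S T c, c != 0 /\ S * P + T * Q = c%:P.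

Lemma bezoutC P Q : bezout P Q -> bezout Q P.
Proof. by move=> [S [T [c [c0 E]]]]; exists T, S, c; rewrite addrC. Qed.

Lemma bezout1 P : bezout P 1.
Proof. by exists 0, 1, 1; rewrite oner_eq0 mul0r add0r mulr1. Qed.

Lemma bezoutM P Q Q' : bezout P Q -> bezout P Q' -> bezout P (Q * Q').
Proof.
move=> [S [T [c [c0 E]]]] [S' [T' [c' [c'0 E']]]].
exists (S * c'%:P + T * Q * S'), (T * T'), (c * c'); split; first by rewrite mulf_neq0.
rewrite polyCM -E -E'; ring.
Qed.

End FractionCoprime.

(** Degrees add in a domain, so the divisor is constant first in the line parameter, then in the [n]
    variables. This is the descent hypothesis of [prime_bezout]. *)
Lemma rdvd_mpolyC_polyC (A : idomainType) n (P : {poly {mpoly A[n]}}) (a : A) :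
  a != 0 -> rdvd P (a%:MP)%:P -> exists2 d, P = (d%:MP)%:P & rdvd d a.
Proof.
move=> a0 [Q E].
have aR0 : (a%:MP)%:P != 0 :> {poly {mpoly A[n]}} by rewrite polyC_eq0 mpolyC_eq0.
have P0 : P != 0 by apply: contraNneq aR0 => P0; rewrite E P0 mul0r.
have Q0 : Q != 0 by apply: contraNneq aR0 => Q0; rewrite E Q0 mulr0.
have : (size P + size Q).-1 = 1%N by rewrite -size_mul // -E size_polyC mpolyC_eq0 a0.
move: (P0) (Q0); rewrite -!size_poly_gt0 => sP sQ sPQ.
have [p PE] : exists p, P = p%:P by exists P`_0; apply: size1_polyC; lia.
have [q QE] : exists q, Q = q%:P by exists Q`_0; apply: size1_polyC; lia.
move: E; rewrite PE QE -polyCM => /polyC_inj E.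
have p0 : p != 0 by rewrite -polyC_eq0 -PE.
have q0 : q != 0 by rewrite -polyC_eq0 -QE.
have : (msize p + msize q).-1 = 1%N by rewrite -msizeM // -E msizeC a0.
move: (p0) (q0); rewrite -!msize_poly_eq0 => mp mq mpq.
have pE : p = (p@_0)%:MP by apply: msize1_polyC; lia.
have qE : q = (q@_0)%:MP by apply: msize1_polyC; lia.
exists p@_0; first by rewrite -pE.
by exists q@_0; apply: (can_inj (@mpolyCK n A)); rewrite mpolyCM -pE -qE.
Qed.

(* Straightening the generic line by an automorphism turns a common factor of
   positive degree in the line parameter into a common factor of u and b. *)
Lemma prime_bezout (A R : idomainType) (emb : {rmorphism A -> R}) (sigma : A -> {poly R})
    (straighten bend : {rmorphism {poly R} -> {poly R}}) (u b : A) :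
  factorial_ring R -> cancel straighten bend -> injective emb ->
  (forall a, straighten (sigma a) = (emb a)%:P) ->
  (forall P a, a != 0 -> rdvd P (emb a)%:P -> exists2 d, P = (emb d)%:P & rdvd d a) ->
  rprime u -> b != 0 -> ~ rdvd u b -> bezout (sigma u) (sigma b).
Proof.
move=> facR sbK embI sigE descend pu b0 ndvd; have [u0 uu _] := pu.
have lu0 : sigma u != 0.
  apply: contraNneq u0 => lu0; have := sigE u; rewrite lu0 rmorph0 => /esym/eqP.
  by rewrite polyC_eq0 -(rmorph0 emb) (inj_eq embI).
case: (poly_bezout facR (sigma b) lu0) => [[D [sD [U uE] [V bE]]]|//].
have dvd a W : sigma a = D * W -> rdvd (straighten D) (emb a)%:P.
  by move=> E; exists (straighten W); rewrite -rmorphM -E sigE.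
have [d DE [x du]] := descend _ _ u0 (dvd _ _ uE).
have [d' D'E db] := descend _ _ b0 (dvd _ _ bE).
have dd' : d = d' by apply: embI; apply: polyC_inj; rewrite -DE -D'E.
case: (rprime_irreducible pu du) => [ud|ux].
  have : D \is a GRing.unit.
    by rewrite -[D]sbK DE; do 3!apply: rmorph_unit.
  by rewrite poly_unitE gtn_eqF.
by case: ndvd; apply: rdvd_trans db; rewrite -dd'; exists x^-1; rewrite du mulrK.
Qed.

(* R is the coordinate ring of a generic line (point base, direction dir) in
   affine n-space over F. *)
Definition generic_line_spec (F K : fieldType) (iota : {rmorphism F -> K}) n (R : idomainType)
    (jR : {rmorphism F -> R}) (base dir : 'I_n -> R) : Prop :=
  [/\ forall u b : {mpoly F[n]}, rprime u -> b != 0 -> ~ rdvd u b ->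
        bezout (line jR base dir u) (line jR base dir b),
      forall a : {mpoly F[n]}, a != 0 -> mmap jR base a != 0,
      forall a : {mpoly F[n]}, a != 0 -> mmap jR dir a != 0 &
      forall c : R, c != 0 -> exists (ev : {rmorphism R -> K}),
        ev c != 0 /\ ev \o jR =1 iota].

Section GenericLine.
Variables (F : fieldType) (K : closedFieldType) (iota : {rmorphism F -> K}) (n : nat).
(* A is an opaque copy of {mpoly F[n]}: unification is very slow on the
   structures of the nested type {mpoly {mpoly F[n]}[n]}. *)
Variables (A : idomainType) (g : {rmorphism {mpoly F[n]} -> A}) (h : {rmorphism A -> {mpoly F[n]}}).
Hypotheses (gK : cancel g h) (hK : cancel h g) (facA : factorial_ring A).
Local Notation R := {mpoly A[n]}.

Let emb : {rmorphism {mpoly F[n]} -> R} := (@mpolyC n A \o g).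
Let jR : {rmorphism F -> R} := (emb \o @mpolyC n F).
Let base (i : 'I_n) : R := emb 'X_i.
Let dir (i : 'I_n) : R := 'X_i.

(** The substitution that moves [base] to [base + e * dir * y] and fixes [dir]. Extended by fixing y
    it is an automorphism with inverse at [- e]; the value -1 collapses the generic line to its base
    point. *)
Let shift_coef (e : F) : R -> {poly R} :=
  mmap (line jR base (fun i => jR e * dir i) \o h) (fun i => (dir i)%:P).
HB.instance Definition _ e := GRing.RMorphism.on (shift_coef e).

Let shift (e : F) : {poly R} -> {poly R} := horner_eval 'X \o map_poly (shift_coef e).
HB.instance Definition _ e := GRing.RMorphism.on (shift e).

Let shiftC e c : shift e c%:P = shift_coef e c.
Proof. by rewrite /shift /= map_polyC /horner_eval hornerC. Qed.

Let shiftX e : shift e 'X = 'X.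
Proof. by rewrite /shift /= map_polyX /horner_eval hornerX. Qed.

Let shift_coef_emb e a : shift_coef e (emb a) = line jR base (fun i => jR e * dir i) a.
Proof. by rewrite /shift_coef mmapC /= gK. Qed.

Let shift_coefX e i : shift_coef e (dir i) = (dir i)%:P.
Proof. by rewrite /shift_coef mmapU. Qed.

Let shift_coef_base e i : shift_coef e (base i) = (base i)%:P + (jR e * dir i)%:P * 'X.
Proof. by rewrite shift_coef_emb lineX. Qed.

Let shift_coef_jR e c : shift_coef e (jR c) = (jR c)%:P.
Proof. by rewrite shift_coef_emb lineC. Qed.

Let shiftM e p q : shift e (p * q) = shift e p * shift e q.
Proof. exact: rmorphM. Qed.

Let shiftD e p q : shift e (p + q) = shift e p + shift e q.
Proof. exact: rmorphD. Qed.

Let shift_coefM e p q : shift_coef e (p * q) = shift_coef e p * shift_coef e q.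
Proof. exact: rmorphM. Qed.

Let shift_line e f a : e + f = 0 ->
  shift f (line jR base (fun i => jR e * dir i) a) = (emb a)%:P.
Proof.
move=> ef0.
apply: (@mpoly_rmorph_eq _ _ _ (shift f \o line jR base _) (polyC \o emb)) => [d|i] /=.
  by rewrite lineC shiftC shift_coef_jR.
rewrite lineX shiftD shiftM shiftX !shiftC shift_coef_base shift_coefM shift_coef_jR shift_coefX.
rewrite -addrA -polyCM -mulrDl -polyCD -mulrDl.
by rewrite -rmorphD addrC addrC [f + e]addrC ef0 rmorph0 mul0r polyC0 mul0r addr0.
Qed.

Let shiftK e f : e + f = 0 -> cancel (shift e) (shift f).
Proof.
move=> ef0; apply: (@poly_rmorph_eq _ _ (shift f \o shift e) idfun) => [c|] /=; last by rewrite !shiftX.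
rewrite shiftC.
apply: (@mpoly_rmorph_eq _ _ _ (shift f \o shift_coef e) polyC) => [a|i] /=; last first.
  by rewrite shift_coefX shiftC shift_coefX.
have -> : a%:MP = emb (h a) by rewrite /emb /= hK.
by rewrite shift_coef_emb shift_line.
Qed.

Let shiftN1_line a : shift (-1) (line jR base dir a) = (emb a)%:P.
Proof.
apply: etrans (@shift_line 1 (-1) a (subrr 1)); apply: (congr1 (shift (-1))).
apply: (@mpoly_rmorph_eq _ _ _ (line jR _ _) (line jR _ _)) => [c|i] /=; first by rewrite !lineC.
by rewrite !lineX rmorph1 mul1r.
Qed.

Let embI : injective emb.
Proof. by move=> x y /= /(can_inj (@mpolyCK n A))/(can_inj gK). Qed.

Lemma generic_line_exists_copy : exists (R : idomainType) (jR : {rmorphism F -> R}) (base dir : 'I_n -> R),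
  generic_line_spec iota jR base dir.
Proof.
exists R, jR, base, dir; split.
- move=> u b; apply: (@prime_bezout _ R emb (line jR base dir) (shift (-1)) (shift 1)).
  + exact: factorial_mpoly.
  + by apply: shiftK; rewrite addNr.
  + exact: embI.
  + exact: shiftN1_line.
  + move=> P a a0 /rdvd_mpolyC_polyC[|d PE [x E]].
      by rewrite -(rmorph0 g) (inj_eq (can_inj gK)).
    exists (h d); first by rewrite /emb /= hK.
    by exists (h x); rewrite -rmorphM -E gK.
- move=> a a0; have -> : mmap jR base a = emb a.
    apply: (@mpoly_rmorph_eq _ _ _ (mmap jR base) emb) => [c|i]; first exact: (mmapC base jR).
    exact: (mmapU jR base).
  by rewrite -(rmorph0 emb) (inj_eq embI).
- move=> a a0; have -> : mmap jR dir a = map_mpoly (g \o @mpolyC n F) a.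
    apply: (@mpoly_rmorph_eq _ _ _ (mmap jR dir) (map_mpoly (g \o @mpolyC n F))) => [c|i].
      by apply: etrans (mmapC dir jR c) _; rewrite /= map_mpolyC.
    by apply: etrans (mmapU jR dir i) _; rewrite /= map_mpolyX.
  apply: contraNneq a0 => E; apply/eqP/mpolyP => m; move/mpolyP/(_ m): E.
  rewrite mcoeff_map_mpoly !mcoeff0 -(rmorph0 g) /= => /(can_inj gK)/eqP.
  by rewrite mpolyC_eq0 => /eqP.
(* The evaluation is chosen in two stages: [beta] keeps the leading coefficient of [c] in the
   direction variables nonzero, then [alpha] keeps the resulting polynomial over K nonzero. *)
move=> c c0; have l0 : h (mleadc c) != 0.
  by rewrite -(rmorph0 h) (inj_eq (can_inj hK)) mleadc_eq0.
have [|beta bl] := @mpoly_nonroot K n (map_mpoly iota (h (mleadc c))).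
  apply: contraNneq l0 => E; apply/eqP/mpolyP => m; move/mpolyP/(_ m): E.
  by rewrite mcoeff_map_mpoly !mcoeff0 => /eqP; rewrite fmorph_eq0 => /eqP.
have ebE a : (map_mpoly iota a).@[beta] = mmap iota beta a.
  apply: (@mpoly_rmorph_eq _ _ _ (meval beta \o map_mpoly iota) (mmap iota beta)) => [d|i] /=.
    by rewrite map_mpolyC mevalC mmapC.
  by rewrite map_mpolyX mevalXU mmapU.
pose eb : {rmorphism A -> K} := (mmap iota beta \o h).
have [|alpha al] := @mpoly_nonroot K n (map_mpoly eb c).
  apply: contraNneq bl => E; move/mpolyP/(_ (mlead c)): E.
  by rewrite mcoeff_map_mpoly !mcoeff0 ebE => /= ->.
exists (mmap eb alpha); split; last by move=> x /=; rewrite [LHS](mmapC alpha eb) /= gK mmapC.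
apply: contraNneq al => E; rewrite -[X in _ == X]E; apply/eqP.
apply: (@mpoly_rmorph_eq _ _ _ (meval alpha \o map_mpoly eb) (mmap eb alpha)) => [d|i] /=.
  by rewrite map_mpolyC mevalC mmapC.
by rewrite map_mpolyX mevalXU mmapU.
Qed.

End GenericLine.

Lemma generic_line_exists (F : fieldType) (K : closedFieldType) (iota : {rmorphism F -> K}) n :
  exists (R : idomainType) (jR : {rmorphism F -> R}) (base dir : 'I_n -> R),
  generic_line_spec iota jR base dir.
Proof.
apply: (@generic_line_exists_copy F K iota n _ idfun idfun) => //.
by apply: factorial_mpoly; apply: factorial_field.
Qed.

(** * Derivations *)

Definition derivation (R : comNzRingType) (D : R -> R) : Prop :=
  (forall a b, D (a + b) = D a + D b) /\ (forall a b, D (a * b) = D a * b + a * D b).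

(** * Derivations of a field of characteristic p *)

Section FieldDerivation.
Variables (F : fieldType) (p : nat).
Hypothesis charF : p \in [pchar F].

Let p_pr : prime p. Proof. by case/andP: charF. Qed.

Lemma exprDp (R : comNzRingType) (x y : R) : p \in [pchar R] -> (x + y) ^+ p = x ^+ p + y ^+ p.
Proof.
by move=> cR; have := pFrobenius_autD_comm cR (mulrC x y); rewrite !pFrobenius_autE.
Qed.

Lemma exprBp (R : comNzRingType) (x y : R) : p \in [pchar R] -> (x - y) ^+ p = x ^+ p - y ^+ p.
Proof.
by move=> cR; have := pFrobenius_autB_comm cR (mulrC x y); rewrite !pFrobenius_autE.
Qed.

Section RootInSubfield.
Variables (L : F -> Prop) (b : F).
Hypotheses (L_exp : forall c, L (c ^+ p)) (LD : forall x y, L x -> L y -> L (x + y))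
  (LM : forall x y, L x -> L y -> L (x * y)).

Let L0 : L 0. Proof. by have := L_exp 0; rewrite expr0n gtn_eqF ?prime_gt0. Qed.
Let L1 : L 1. Proof. by have := L_exp 1; rewrite expr1n. Qed.

Let LX x k : L x -> L (x ^+ k).
Proof. by move=> Lx; elim: k => [|k IH]; rewrite ?expr0 ?exprS //; apply: LM. Qed.

Let LN x : L x -> L (- x).
Proof.
move=> Lx; have -> : - x = (p.-1)%:R * x.
  by apply/eqP; rewrite eq_sym -addr_eq0 -{2}[x]mul1r -mulrDl natr1 prednK ?prime_gt0 // (pcharf0 charF) mul0r.
by apply: LM => //; elim: (p.-1) => [|k IH] //; rewrite -natr1; apply: LD.
Qed.

(** A subring containing all p-th powers is a field: the inverse of x is x^(p-1) times the p-th
    power of x^-1. *)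
Let LV x : L x -> L x^-1.
Proof.
move=> Lx; have [->|x0] := eqVneq x 0; first by rewrite invr0.
have -> : x^-1 = x ^+ p.-1 * x^-1 ^+ p.
  by rewrite -[in x^-1 ^+ p](prednK (prime_gt0 p_pr)) exprS mulrCA -exprMn divff // expr1n mulr1.
by apply: LM => //; apply: LX.
Qed.

(* The minimal polynomial of b over L divides X^p - b^p = (X - b)^p, so it is
   (X - b)^k with k < p, and k b is one of its coefficients. *)
Lemma pth_root_in_subfield (P : {poly F}) :
  (forall i, L P`_i) -> P != 0 -> (size P <= p)%N -> P.[b] = 0 -> L b.
Proof.
move=> LP P0 sP Pb.
pose ok k := `[< exists Q : {poly F}, [/\ forall i, L Q`_i, Q != 0, size Q = k & Q.[b] = 0] >].
have ex_ok : exists k, ok k by exists (size P); apply/asboolP; exists P.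
case: (ex_minnP ex_ok) => m /asboolP[Q [LQ Q0 sQ Qb]] minm.
have lem : (m <= p)%N by apply: leq_trans (minm _ _) sP; apply/asboolP; exists P.
have gm1 : (1 < m)%N.
  rewrite ltnNge; apply/negP => le1; have QE : Q = (Q`_0)%:P by apply: size1_polyC; rewrite sQ.
  by move: Q0 Qb; rewrite QE hornerC polyC_eq0 => /eqP.
(* Euclidean division with coefficients in [L], done by hand because [L] is only a predicate.
   Minimality of [m] gives [size Q <= size T]. *)
have dvdQ : forall k (T : {poly F}), (size T <= k)%N -> (forall i, L T`_i) -> T.[b] = 0 -> Q %| T.
  elim=> [|k IH] T sT LT Tb; first by move: sT; rewrite size_poly_leq0 => /eqP->; rewrite dvdp0.
  have [->|T0] := eqVneq T 0; first by rewrite dvdp0.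
  have leQT : (size Q <= size T)%N.
    by rewrite sQ; apply: minm; apply/asboolP; exists T.
  pose c := lead_coef T / lead_coef Q; pose d := (size T - size Q)%N.
  have szE : (size (c *: ('X^d * Q)) <= size T)%N.
    apply: leq_trans (size_scale_leq _ _) _.
    by rewrite mulrC size_Mmonic ?monicXn // size_polyXn addnS /= addnC subnK.
  have cE : (c *: ('X^d * Q))`_(size T).-1 = lead_coef T.
    rewrite coefZ coefXnM; have -> : (((size T).-1 < d) = false)%N.
      by apply/negbTE; rewrite -leqNgt /d; move: leQT; rewrite sQ; lia.
    have -> : ((size T).-1 - d = (size Q).-1)%N by rewrite /d; move: leQT; rewrite sQ; lia.
    by rewrite -/(lead_coef Q) /c divfK // lead_coef_eq0.
  have dT' : Q %| T - c *: ('X^d * Q).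
    apply: IH.
    - apply/leq_sizeP => i lei; rewrite coefB.
      have [->|ne] := eqVneq i (size T).-1; first by rewrite cE subrr.
      have lti : (size T <= i)%N by move: ne lei sT; lia.
      by rewrite !nth_default ?subr0 //; apply: leq_trans szE lti.
    - move=> i; rewrite coefB coefZ coefXnM; apply: LD => //; apply: LN; apply: LM.
        by apply: LM; [apply: LT|apply: LV; apply: LQ].
      by case: ifP.
    - by rewrite hornerD hornerN hornerZ hornerM Qb Tb !mulr0 subr0.
  rewrite -[T](subrK (c *: ('X^d * Q))) dvdp_add //.
  by rewrite -mul_polyC; apply: dvdp_mull; apply: dvdp_mulIr.
have charP : p \in [pchar {poly F}] by rewrite pchar_poly.
have XpE : 'X^p - (b ^+ p)%:P = ('X - b%:P) ^+ p.
  by rewrite exprBp // polyC_exp.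
have /dvdp_exp_XsubCP[k _ Qk] : Q %| ('X - b%:P) ^+ p.
  rewrite -XpE; apply: (dvdQ (size ('X^p - (b ^+ p)%:P))) => // [i|].
    rewrite coefB coefXn coefC; apply: LD; last by apply: LN; case: eqP.
    by case: eqP.
  by rewrite hornerD hornerN hornerXn hornerC subrr.
have sk : k = m.-1 by move/eqp_size: Qk; rewrite sQ size_exp_XsubC => ->.
have /eqpP[[c1 c2] /= /andP[c10 c20] E] := Qk.
have kp : (0 < k < p)%N by move: gm1 lem; rewrite sk; lia.
have k0 : k%:R != 0 :> F.
  by rewrite -(dvdn_pcharf charF) gtnNdvd; case/andP: kp.
have coefk : (('X - b%:P) ^+ k)`_k.-1 = - (k%:R * b).
  have := @coefPn_prod_XsubC F (nseq k b); rewrite size_nseq !big_nseq iter_mulr_1 iter_addr_0 mulr_natl.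
  by apply; move: kp; case: (k).
have coefk1 : (('X - b%:P) ^+ k)`_k = 1.
  have : lead_coef (('X - b%:P) ^+ k) = 1 by apply/eqP/monic_exp/monicXsubC.
  by rewrite /lead_coef size_exp_XsubC.
have QE i : c1 * Q`_i = c2 * (('X - b%:P) ^+ k)`_i by rewrite -!coefZ E.
have Qk0 : Q`_k != 0.
  by apply: contraNneq c20 => Qk0; rewrite -[c2]mulr1 -coefk1 -QE Qk0 mulr0.
have -> : b = - (Q`_k.-1 / Q`_k / k%:R).
  apply: (mulfI k0); apply: (mulfI Qk0); apply: (mulfI c10).
  rewrite mulrA QE coefk1 mulr1.
  have -> : c1 * (Q`_k * (k%:R * - (Q`_k.-1 / Q`_k / k%:R))) = - (c1 * Q`_k.-1) by field; rewrite ?Qk0 ?k0.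
  by rewrite QE coefk mulrN opprK.
apply: LN; apply: LM; first by apply: LM => //; apply: LV.
by apply: LV; elim: (k) => [|k' IH] //; rewrite -natr1; apply: LD.
Qed.

End RootInSubfield.

(* G is the graph of a derivation into F of a subfield of F containing F^p. *)
Definition derivation_graph (G : F * F -> Prop) : Prop :=
  [/\ forall c, G (c ^+ p, 0),
      forall x y, G x -> G y -> G (x.1 + y.1, x.2 + y.2),
      forall x y, G x -> G y -> G (x.1 * y.1, x.1 * y.2 + x.2 * y.1) &
      forall v, G (0, v) -> v = 0].

(** [Q] holds the derivatives of the coefficients of [P], so the second component is the value at
    P(b) that the Leibniz rule forces once [b] is sent to [v]. *)
Definition graph_adjoin (G : F * F -> Prop) (b v : F) (z : F * F) : Prop :=
  exists P Q : {poly F}, (forall i, G (P`_i, Q`_i)) /\ z = (P.[b], Q.[b] + P^`().[b] * v).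

(** The point is that the extension is single-valued. A relation P(b) = 0 of degree below p is
    trivial by [pth_root_in_subfield], as [b] is outside the domain. Higher relations are reduced
    modulo X^p - b^p, whose formal derivative is zero and whose coefficients are sent to 0 by the
    derivation. *)
Lemma derivation_graph_adjoin G b v : derivation_graph G -> (forall w, ~ G (b, w)) ->
  [/\ derivation_graph (graph_adjoin G b v), forall z, G z -> graph_adjoin G b v z &
      graph_adjoin G b v (b, v)].
Proof.
move=> [Gp GD GM Gf] nb.
have G00 : G (0, 0) by have := Gp 0; rewrite expr0n gtn_eqF ?prime_gt0.
have G10 : G (1, 0) by have := Gp 1; rewrite expr1n.
have sub z : G z -> graph_adjoin G b v z.
  case: z => x y Gxy; exists x%:P, y%:P; split=> [i|].
    by rewrite !coefC; case: eqP.
  by rewrite !hornerC derivC horner0 mul0r addr0.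
have Gsum (I : Type) (r : seq I) (f g : I -> F) : (forall i, G (f i, g i)) ->
    G (\sum_(i <- r) f i, \sum_(i <- r) g i).
  move=> Gfg; elim: r => [|i r IH]; first by rewrite !big_nil.
  by rewrite !big_cons; apply: (GD (_, _) (_, _)).
have Gv : graph_adjoin G b v (b, v).
  exists 'X, 0; split; last by rewrite derivX !hornerE.
  by move=> i; rewrite coefX coef0; case: eqP.
split=> //; split.
- by move=> c; apply: sub.
- move=> _ _ [P [Q [GPQ ->]]] [P' [Q' [GPQ' ->]]]; exists (P + P'), (Q + Q'); split=> [i|].
    by rewrite !coefD; apply: (GD (_, _) (_, _)).
  by rewrite derivD !hornerD /=; congr (_, _); ring.
- move=> _ _ [P [Q [GPQ ->]]] [P' [Q' [GPQ' ->]]].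
  exists (P * P'), (P * Q' + Q * P'); split=> [i|].
    rewrite coefD !coefM -big_split /=; apply: Gsum => j.
    exact: (GM (_, _) (_, _)).
  by rewrite derivM !(hornerD, hornerM) /=; congr (_, _); ring.
move=> w [P [Q [GPQ [Pb ->]]]].
suff main : forall k (P Q : {poly F}), (size P <= k)%N -> (size Q <= k)%N ->
    (forall i, G (P`_i, Q`_i)) -> P.[b] = 0 -> Q.[b] + P^`().[b] * v = 0.
  by apply: (main (maxn (size P) (size Q))); rewrite ?leq_maxl ?leq_maxr.
elim=> [|k IH] {Pb GPQ}P {}Q sP sQ GPQ Pb.
  move: sP sQ; rewrite !size_poly_leq0 => /eqP-> /eqP->.
  by rewrite deriv0 !horner0 mul0r addr0.
have [ltkp|lepk] := ltnP k p.
  have P0 : P = 0.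
    apply/eqP; apply: contraT => P0.
    have [||||w' Gw] := @pth_root_in_subfield (fun x => exists y, G (x, y)) b _ _ _ P _ P0 (leq_trans sP ltkp) Pb.
    - by move=> c; exists 0.
    - by move=> x y [x' Gx] [y' Gy]; exists (x' + y'); apply: (GD (_, _) (_, _)).
    - by move=> x y [x' Gx] [y' Gy]; eexists; apply: (GM (_, _) (_, _)); eassumption.
    - by move=> i; exists Q`_i.
    by case: (nb w').
  have Q0 : Q = 0 by apply/polyP => i; rewrite coef0; apply: Gf; have := GPQ i; rewrite P0 coef0.
  by rewrite P0 Q0 deriv0 !horner0 mul0r addr0.
pose red (S : {poly F}) : {poly F} := S - S`_k *: ('X^(k - p) * ('X^p - (b ^+ p)%:P)).
have redE S i : (red S)`_i = S`_i - S`_k * ((i == k)%:R - b ^+ p * (i == k - p)%N%:R).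
  rewrite /red coefB coefZ mulrBr -exprD subnK // coefB coefXn coefMC coefXn.
  by rewrite [_ * b ^+ p]mulrC.
have red_size (S : {poly F}) : (size S <= k.+1)%N -> (size (red S) <= k)%N.
  move=> sS; apply/leq_sizeP => i; rewrite leq_eqVlt redE => /orP[/eqP<-|lti].
    rewrite eqxx (_ : (k == (k - p)%N) = false) ?mulr0 ?subr0 ?mulr1 ?subrr //.
    by apply/negbTE; rewrite neq_ltn; move: (prime_gt0 p_pr) lepk; lia.
  rewrite gtn_eqF // gtn_eqF; last by apply: leq_ltn_trans lti; rewrite leq_subr.
  by rewrite mulr0 subrr mulr0 subr0 nth_default //; apply: leq_trans sS lti.
have E0 : ('X^p - (b ^+ p)%:P).[b] = 0 by rewrite hornerD hornerN hornerXn hornerC subrr.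
have dE0 : ('X^p - (b ^+ p)%:P)^`() = 0.
  by rewrite derivB derivC derivXn subr0 -mulr_natr (pcharf0 (_ : p \in [pchar {poly F}])) ?pchar_poly // mulr0.
have red_b (S : {poly F}) : (red S).[b] = S.[b].
  by rewrite /red hornerD hornerN hornerZ hornerM E0 !mulr0 subr0.
have red_d (S : {poly F}) : (red S)^`().[b] = S^`().[b].
  by rewrite /red derivB derivZ derivM dE0 mulr0 addr0 hornerD hornerN hornerZ hornerM E0 !mulr0 subr0.
rewrite -red_b -red_d; apply: IH; rewrite ?red_b //; try exact: red_size.
move=> i; rewrite !redE; have Gk := GPQ k; have Gi := GPQ i.
(* Additivity of Frobenius packs both indicators into a single p-th power, which [G] sends to 0. *)
pose e := b * (i == k - p)%N%:R - (i == k)%:R.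
have eE : - ((i == k)%:R - b ^+ p * (i == k - p)%N%:R) = e ^+ p.
  rewrite /e exprBp // exprMn opprB.
  by congr (_ * _ - _); case: eqP => _; rewrite ?expr1n ?expr0n ?gtn_eqF ?prime_gt0.
have := GD _ _ Gi (GM _ _ (Gp e) Gk); rewrite /= mul0r addr0 -eE.
by rewrite !mulNr ![(_ - _ ) * _]mulrC.
Qed.

Lemma field_derivation (a : F) : (forall c, a <> c ^+ p) ->
  exists2 d, derivation d & d a = 1.
Proof.
move=> na.
have G0g : derivation_graph (fun z => exists c, z = (c ^+ p, 0)).
  split=> [c|_ _ [c ->] [d ->]|_ _ [c ->] [d ->]|v [c [_ ->]]] //; first by exists c.
    by exists (c + d); rewrite /= exprDp // addr0.
  by exists (c * d); rewrite /= exprMn mulr0 mul0r addr0.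
have [|G1g G1sub G1a] := @derivation_graph_adjoin _ a 1 G0g; first by move=> w [c [/na]].
pose good (G : F * F -> Prop) := (forall z, ~ G z) \/ (derivation_graph G /\ G (a, 1)).
have [|G [Ggood Gmax]] := @classical_sets.Zorn_bigcup (F * F)%type good.
  move=> C Cgood Ctot.
  have [[X0 CX0 [z0 X0z0]]|empty] := pselect (exists2 X, C X & exists z, X z); last first.
    by left=> z [X CX Xz]; apply: empty; exists X => //; exists z.
  have CE X z : C X -> X z -> derivation_graph X /\ X (a, 1).
    by move=> CX Xz; case: (Cgood X CX) => // /(_ z).
  have both X Y x y : C X -> C Y -> X x -> Y y -> exists2 Z, C Z & Z x /\ Z y.
    by move=> CX CY Xx Yy; case: (Ctot X Y CX CY) => sXY; [exists Y|exists X] => //; split=> //; apply: sXY.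
  have [[X0p _ _ _] X0a] := CE _ _ CX0 X0z0.
  right; split; last by exists X0.
  split.
  - by move=> c; exists X0 => //; apply: X0p.
  - move=> x y [X CX Xx] [Y CY Yy]; have [Z CZ [Zx Zy]] := both _ _ _ _ CX CY Xx Yy.
    by exists Z => //; have [[_ ZD _ _] _] := CE _ _ CZ Zx; apply: ZD.
  - move=> x y [X CX Xx] [Y CY Yy]; have [Z CZ [Zx Zy]] := both _ _ _ _ CX CY Xx Yy.
    by exists Z => //; have [[_ _ ZM _] _] := CE _ _ CZ Zx; apply: ZM.
  - by move=> v [X CX Xv]; have [[_ _ _ Xf] _] := CE _ _ CX Xv; apply: Xf.
have [Gg Ga] : derivation_graph G /\ G (a, 1).
  case: Ggood => // Ge; case: (Gmax (graph_adjoin (fun z => exists c, z = (c ^+ p, 0)) a 1)); last by right.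
  by split=> [z /Ge //|/(_ _ G1a)/Ge].
(* Any [b] missing from the domain could be adjoined with derivative 0, against maximality. *)
have tot b : exists w, G (b, w).
  apply: contrapT => /forallNP nb; have [G'g G'sub G'b] := derivation_graph_adjoin 0 Gg nb.
  apply: (Gmax (graph_adjoin G b 0)); last by right; split=> //; apply: G'sub.
  by split=> [z /G'sub //|/(_ _ G'b)/nb].
have [d dG] := choice tot; have [Gp GD GM Gf] := Gg.
have uniq x v w : G (x, v) -> G (x, w) -> v = w.
  move=> Gv Gw; apply/eqP; rewrite -subr_eq0; apply/eqP/Gf.
  have := GD _ _ Gv (GM _ _ (Gp (-1)) Gw).
  have -> : (-1) ^+ p = -1 :> F by rewrite -sub0r exprBp // expr1n expr0n gtn_eqF ?prime_gt0.
  by rewrite /= !mulN1r mul0r addr0 subrr.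
exists d; last by apply: (uniq a).
split=> x y; apply: uniq (dG _) _; first exact: GD (dG x) (dG y).
by have := GM _ _ (dG x) (dG y); rewrite /= addrC.
Qed.

End FieldDerivation.

Lemma derivation0 (R : comNzRingType) (D : R -> R) : derivation D -> D 0 = 0.
Proof. by case=> DD _; apply: (addrI (D 0)); rewrite -DD !addr0. Qed.

Lemma derivation1 (R : comNzRingType) (D : R -> R) : derivation D -> D 1 = 0.
Proof.
by case=> _ DM; apply: (addrI (D 1)); rewrite addr0 -{3}[1]mulr1 DM mul1r mulr1.
Qed.

Lemma derivationB (R : comNzRingType) (D : R -> R) : derivation D ->
  forall a b, D (a - b) = D a - D b.
Proof.
move=> dD a b; apply: (addIr (D b)); case: dD => DD _.
by rewrite -DD !subrK.
Qed.

Lemma leq_predD x y : y != 0%N -> (x <= (x + y).-1)%N.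
Proof. lia. Qed.

Lemma predD_leq x y : x != 0%N -> ((x + y).-1 <= x)%N -> (y <= 1)%N.
Proof. lia. Qed.

Section MpolyDerivation.
Variables (F : fieldType) (n p : nat).
Hypothesis charF : p \in [pchar F].
Implicit Types (q u w : {mpoly F[n]}).

(* Coefficientwise derivations of F must be allowed besides the partial
   derivatives: over an imperfect field all partials of an irreducible
   polynomial may vanish. *)
Definition degree_derivation (D : {mpoly F[n]} -> {mpoly F[n]}) : Prop :=
  [/\ derivation D, forall c, exists c', D c%:MP = c'%:MP,
      forall i, exists c, D 'X_i = c%:MP & forall q, (msize (D q) <= msize q)%N].

Lemma msize_leP q k : (forall m, m \in msupp q -> (mdeg m < k)%N) -> (msize q <= k)%N.
Proof. by move=> H; rewrite msizeE; apply/bigmax_leqP_seq => m mq _; apply: H. Qed.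

Lemma msize_rdvd u q : q != 0 -> rdvd u q -> (msize u <= msize q)%N.
Proof.
move=> q0 [b qE]; move: q0; rewrite qE mulf_eq0 negb_or => /andP[u0 b0].
by rewrite msizeM //; apply: leq_predD; rewrite msize_poly_eq0.
Qed.

Lemma msize_mderiv i q : q != 0 -> (msize (mderiv i q) < msize q)%N.
Proof.
move=> q0; rewrite -[msize q]prednK ?lt0n ?msize_poly_eq0 // ltnS; apply: msize_leP => m.
rewrite mcoeff_msupp mcoeff_deriv => nz.
have : (m + U_(i))%MM \in msupp q.
  by rewrite mcoeff_msupp; apply: contraNneq nz => ->; rewrite mul0rn.
by move/msize_mdeg_lt; rewrite mdegD mdeg1; lia.
Qed.

Lemma mderiv_degree_derivation i : degree_derivation (mderiv i).
Proof.
split.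
- by split=> a b; rewrite ?mderivD ?mderivM.
- by move=> c; exists 0; rewrite mderivC mpolyC0.
- move=> j; rewrite mderivX mnm1E; case: eqP => [->|_].
    have -> : (U_(i) - U_(i))%MM = 0%MM by apply/mnmP => k; rewrite mnmBE subnn mnm0E.
    by exists 1; rewrite scale1r mpolyX0 mpolyC1.
  by exists 0; rewrite scale0r mpolyC0.
- move=> q; have [->|q0] := eqVneq q 0; first by rewrite mderiv0.
  exact/ltnW/msize_mderiv.
Qed.

Section CoefDerivation.
Variable d : F -> F.
Hypothesis dd : derivation d.

Let d_is_additive : zmod_morphism d. Proof. exact: derivationB. Qed.
HB.instance Definition _ := GRing.isZmodMorphism.Build F F d d_is_additive.

Lemma coef_degree_derivation : degree_derivation (map_mpoly d).
Proof.
split.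
- split=> [a b|a b]; first exact: raddfD.
  apply/mpolyP => m; rewrite mcoeff_map_mpoly mcoeffD !mcoeffM raddf_sum -big_split /=.
  by apply: eq_bigr => k _; rewrite !mcoeff_map_mpoly; case: dd.
- by move=> c; exists (d c); rewrite map_mpolyC.
- move=> i; exists 0; apply/mpolyP => m; rewrite mcoeff_map_mpoly mpolyC0 mcoeff0 mcoeffX.
  by case: eqP => _; [apply: derivation1|apply: derivation0].
- move=> q; apply: msize_leP => m; rewrite mcoeff_msupp mcoeff_map_mpoly => nz.
  apply: msize_mdeg_lt; rewrite mcoeff_msupp; apply: contraNneq nz => ->.
  by rewrite derivation0.
Qed.

(** Scale [u] to leading coefficient 1. If it divided its derivative, the quotient would be constant
    by degrees, and comparing leading coefficients would make it 0, since 1 has derivative 0; then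
    every normalized coefficient would have derivative 0. *)
Lemma coef_derivation_ndvd u m : u != 0 -> d (u@_m / mleadc u) != 0 ->
  ~ rdvd u (map_mpoly d u).
Proof.
move=> u0 dm [b E]; set l := mleadc u in dm *.
have l0 : l != 0 by rewrite mleadc_eq0.
have [[_ DM] DC _ Ds] := coef_degree_derivation.
pose v := l^-1 *: u; have uE : u = l *: v by rewrite /v scalerA divff // scale1r.
have v0 : v != 0 by rewrite /v mscalerI invr_eq0 negb_or l0.
pose c : {mpoly F[n]} := b - (d l / l)%:MP.
have Dv : map_mpoly d v = v * c.
  apply: (@mulfI _ l%:MP); first by rewrite mpolyC_eq0.
  have : map_mpoly d u = (d l)%:MP * v + l%:MP * map_mpoly d v.
    by rewrite {1}uE -mul_mpolyC DM map_mpolyC.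
  rewrite E {1}uE -mul_mpolyC => Eq.
  have -> : l%:MP * map_mpoly d v = l%:MP * v * b - (d l)%:MP * v by rewrite Eq addrAC subrr add0r.
  rewrite /c mulrBr mulrBr [v * _%:MP]mulrC [l%:MP * (_%:MP * _)]mulrA -mpolyCM mulrA.
  by rewrite [l * _]mulrC divfK.
have Dv0 : map_mpoly d v != 0.
  by apply: contraNneq dm => /mpolyP/(_ m); rewrite mcoeff_map_mpoly mcoeff0 mcoeffZ mulrC => ->.
have c0 : c != 0 by apply: contraNneq Dv0 => c0; rewrite Dv c0 mulr0.
have sc : (msize c <= 1)%N.
  by have := Ds v; rewrite Dv msizeM //; apply: predD_leq; rewrite msize_poly_eq0.
have /mpolyP/(_ (mlead u)) := Dv; rewrite (msize1_polyC sc) mcoeff_map_mpoly mulrC mcoeffCM mcoeffZ.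
rewrite -/l mulVf // mulr1 derivation1 // => /esym c00.
by move: c0; rewrite (msize1_polyC sc) c00 mpolyC0 eqxx.
Qed.

End CoefDerivation.

Lemma prime_degree_derivation u : rprime u ->
  exists2 D, degree_derivation D & ~ rdvd u (D u).
Proof.
move=> pu; have [u0 uu _] := pu.
have [[i di]|/forallNP d0] := pselect (exists i, mderiv i u != 0).
  exists (mderiv i); first exact: mderiv_degree_derivation.
  by move/(msize_rdvd di); rewrite leqNgt msize_mderiv.
have p_pr : prime p by case/andP: charF.
have [[m nm]|/forallNP pth] := pselect (exists m, forall c, u@_m / mleadc u <> c ^+ p).
  have [d dd d1] := field_derivation charF nm.
  exists (map_mpoly d); first exact: coef_degree_derivation.
  by apply: (coef_derivation_ndvd dd (m := m)) => //; rewrite d1 oner_eq0.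
have l0 : mleadc u != 0 by rewrite mleadc_eq0.
have /choice[r rE] : forall m, exists c, u@_m / mleadc u = c ^+ p.
  by move=> m; have /existsNP[c /contrapT] := pth m; exists c.
(* In characteristic p a vanishing partial derivative forces every exponent of its variable to be a
   multiple of p. *)
have dvd (m : 'X_{1..n}) i : m \in msupp u -> (p %| m i)%N.
  move=> mu; have /negP/negPn/eqP/mpolyP := d0 i.
  have [->|mi] := eqVneq (m i) 0%N; first by rewrite dvdn0.
  move/(_ (m - U_(i))%MM); rewrite mcoeff_deriv mcoeff0 submK; last by rewrite lep1mP.
  rewrite mnmBE mnm1E eqxx subn1 prednK ?lt0n // -mulr_natr => /eqP.
  by rewrite mulf_eq0 mcoeff_eq0 mu /= -(dvdn_pcharf charF).
have charM : p \in [pchar {mpoly F[n]}].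
  by rewrite inE p_pr /= -mpolyC_nat (pcharf0 charF) mpolyC0.
(* The p-th root of the normalized [u]: p-th roots of the coefficients, exponents divided by p. Its
   existence contradicts primality. *)
pose w : {mpoly F[n]} := \sum_(m <- msupp u) r m *: 'X_[[multinom (m i %/ p)%N | i < n]].
have wE : u = (mleadc u)%:MP * w ^+ p.
  rewrite -(pFrobenius_autE charM) rmorph_sum /= mulr_sumr {1}[u]mpolyE.
  rewrite big_seq [RHS]big_seq; apply: eq_bigr => m mu.
  rewrite pFrobenius_autE exprZn -rE mul_mpolyC scalerA mulrCA divff // mulr1; congr (_ *: _).
  rewrite mpolyXn; congr 'X_[_]; apply/mnmP => i.
  by rewrite mulmnE mnmE divnK // dvd.
have nuw : w \isn't a GRing.unit.
  apply: contra uu => uw; rewrite wE unitrM unitrX // andbT.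
  by apply: rmorph_unit; rewrite unitfE.
have : u = ((mleadc u)%:MP * w ^+ p.-1) * w by rewrite -mulrA -exprSr prednK ?prime_gt0.
case/(rprime_irreducible pu) => [|uw]; last by rewrite uw in nuw.
rewrite unitrM => /andP[_ uw]; case/negP: nuw; apply: rdvd_unit uw.
by exists (w ^+ p.-2); rewrite -exprS prednK // -ltnS prednK ?prime_gt0 // prime_gt1.
Qed.

End MpolyDerivation.

(** * Straight-line programs *)

Section StraightLine.
Variables (R : comNzRingType) (n : nat).
Local Notation P := {mpoly R[n]}.
Implicit Types (A B V W : seq {mpoly R[n]}) (x y : {mpoly R[n]}) (k : nat).

(** Values are recorded instead of gate positions, so programs compose by list concatenation without
    renumbering. *)
Definition slp_step A x : Prop :=
  [\/ exists c, x = c%:MP, exists i, x = 'X_i |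
      exists a b, [/\ a \in A, b \in A & x = a + b \/ x = a * b]].

(* B lists the computed values, latest first. *)
Fixpoint slp A B : Prop :=
  if B is x :: B' then slp_step (B' ++ A) x /\ slp A B' else True.

(** [A] is available free of charge and [V] may list several values, so shared subcomputations are
    paid once. *)
Definition slp_computes A k V : Prop :=
  exists B, [/\ slp A B, (size B <= k)%N & {subset V <= B ++ A}].

Lemma slp_step_sub A A' x : {subset A <= A'} -> slp_step A x -> slp_step A' x.
Proof.
move=> sA [cx|ix|[a [b [aA bA xE]]]]; [exact: Or31|exact: Or32|apply: Or33].
by exists a, b; split=> //; apply: sA.
Qed.

Lemma slp_sub A A' B : {subset A <= A'} -> slp A B -> slp A' B.
Proof.
move=> sA; elim: B => //= x B IH [sx /IH]; split=> //; apply: slp_step_sub sx.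
by move=> y; rewrite !mem_cat => /orP[->|/sA->]; rewrite ?orbT.
Qed.

Lemma slp_cat A B B' : slp A B -> slp (B ++ A) B' -> slp A (B' ++ B).
Proof. by move=> sB; elim: B' => //= x B' IH [sx /IH]; rewrite -catA. Qed.

Lemma slp_computes_sub A A' k k' V V' : {subset A <= A'} -> (k <= k')%N ->
  {subset V' <= V} -> slp_computes A k V -> slp_computes A' k' V'.
Proof.
move=> sA lek sV [B [sB szB VB]]; exists B; split; first exact: slp_sub sB.
  exact: leq_trans lek.
by move=> x /sV/VB; rewrite !mem_cat => /orP[->|/sA->]; rewrite ?orbT.
Qed.

Lemma slp_computes_leq A k k' V : (k <= k')%N -> slp_computes A k V -> slp_computes A k' V.
Proof. by move=> ?; apply: slp_computes_sub. Qed.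

Lemma slp_computes_mem A V : {subset V <= A} -> slp_computes A 0 V.
Proof. by exists [::]. Qed.

Lemma slp_computes_in A x : x \in A -> slp_computes A 0 [:: x].
Proof. by move=> xA; apply: slp_computes_mem => y; rewrite inE => /eqP->. Qed.

Lemma slp_computes_in_catl A A' x : x \in A -> slp_computes (A ++ A') 0 [:: x].
Proof. by move=> xA; apply: slp_computes_in; rewrite mem_cat xA. Qed.

Lemma slp_computes_in_catr A A' x : x \in A' -> slp_computes (A ++ A') 0 [:: x].
Proof. by move=> xA; apply: slp_computes_in; rewrite mem_cat xA orbT. Qed.

Lemma slp_computes_trans A k k' V W : slp_computes A k V ->
  slp_computes (V ++ A) k' W -> slp_computes A (k + k') (W ++ V).
Proof.
move=> [B [sB szB VB]] [B' [sB' szB' WB]]; exists (B' ++ B); split.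
- apply: slp_cat => //; apply: slp_sub sB' => x; rewrite mem_cat => /orP[/VB//|xA].
  by rewrite mem_cat xA orbT.
- by rewrite size_cat addnC leq_add.
- move=> x; rewrite mem_cat -catA => /orP[/WB|/VB]; rewrite !mem_cat.
    by case/orP=> [->//|/orP[/VB|->]]; rewrite ?mem_cat ?orbT // => ->; rewrite orbT.
  by move=> ->; rewrite orbT.
Qed.

Lemma slp_computes_bind A k k' V W : slp_computes A k V ->
  slp_computes (V ++ A) k' W -> slp_computes A (k + k') W.
Proof.
move=> cV cW; apply: slp_computes_sub (slp_computes_trans cV cW) => // x xW.
by rewrite mem_cat xW.
Qed.

Lemma slp_computes_cat A k k' V W : slp_computes A k V ->
  slp_computes A k' W -> slp_computes A (k + k') (V ++ W).
Proof.
move=> cV cW; apply: (@slp_computes_sub A A (k + k') _ (W ++ V)) => //.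
  by move=> x; rewrite !mem_cat orbC.
apply: slp_computes_trans cV _; apply: slp_computes_sub cW => // x xA.
by rewrite mem_cat xA orbT.
Qed.

Lemma slp_computes_seq A k (I : eqType) (r : seq I) (f : I -> P) :
  (forall i, i \in r -> slp_computes A k [:: f i]) ->
  slp_computes A (k * size r) (map f r).
Proof.
elim: r => [|i r IH] H; first by rewrite muln0; apply: slp_computes_mem.
rewrite /= mulnS -cat1s; apply: slp_computes_cat; first by apply: H; rewrite mem_head.
by apply: IH => j jr; apply: H; rewrite inE jr orbT.
Qed.

Lemma slp_computes_fam A k m (f : 'I_m -> P) :
  (forall i, slp_computes A k [:: f i]) -> slp_computes A (k * m) (codom f).
Proof.
move=> H; rewrite -[m in (k * m)%N]card_ord cardE /codom /image_mem.
by apply: slp_computes_seq => i _.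
Qed.

Lemma slp_computes_const A c : slp_computes A 1 [:: c%:MP].
Proof.
exists [:: c%:MP]; split=> //=; last by move=> x; rewrite inE => /eqP->; rewrite mem_head.
by split=> //; apply: Or31; exists c.
Qed.

Lemma slp_computes_var A i : slp_computes A 1 [:: 'X_i].
Proof.
exists [:: 'X_i]; split=> //=; last by move=> x; rewrite inE => /eqP->; rewrite mem_head.
by split=> //; apply: Or32; exists i.
Qed.

Let slp_computes_op (op : P -> P -> P) A k k' x y :
  (forall a b B, a \in B -> b \in B -> slp_step B (op a b)) ->
  slp_computes A k [:: x] -> slp_computes A k' [:: y] ->
  slp_computes A (k + k').+1 [:: op x y].
Proof.
move=> opS cx cy; rewrite -addn1; apply: slp_computes_bind (slp_computes_cat cx cy) _.
exists [:: op x y]; split=> //=; last by move=> z; rewrite inE => /eqP->; rewrite mem_head.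
by split=> //; apply: opS; rewrite !inE eqxx ?orbT.
Qed.

Lemma slp_computesD A k k' x y : slp_computes A k [:: x] -> slp_computes A k' [:: y] ->
  slp_computes A (k + k').+1 [:: x + y].
Proof. by apply: slp_computes_op => a b B aB bB; apply: Or33; exists a, b; split=> //; left. Qed.

Lemma slp_computesM A k k' x y : slp_computes A k [:: x] -> slp_computes A k' [:: y] ->
  slp_computes A (k + k').+1 [:: x * y].
Proof. by apply: slp_computes_op => a b B aB bB; apply: Or33; exists a, b; split=> //; right. Qed.

Lemma slp_computesB A k k' x y : slp_computes A k [:: x] -> slp_computes A k' [:: y] ->
  slp_computes A (k + k').+3 [:: x - y].
Proof.
move=> cx cy; rewrite -mulN1r -[-1]mulr1 -mpolyC1 -mpolyCN.
have c1 := slp_computesM (slp_computes_const A (-1)) cy.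
apply: slp_computes_sub (slp_computesD cx c1) => //; first by lia.
by rewrite mpolyC1 mulr1.
Qed.

Lemma slp_computes_sum A k (I : eqType) (r : seq I) (f : I -> P) :
  (forall i, i \in r -> slp_computes A k [:: f i]) ->
  slp_computes A (k.+1 * size r).+1 [:: \sum_(i <- r) f i].
Proof.
elim: r => [|i r IH] H; first by rewrite big_nil -mpolyC0 muln0; apply: slp_computes_const.
rewrite big_cons /= mulnS; apply: slp_computes_leq (slp_computesD (H i (mem_head _ _)) (IH _)).
  by lia.
by move=> j jr; apply: H; rewrite inE jr orbT.
Qed.

Lemma slp_computes_prod A k (I : eqType) (r : seq I) (f : I -> P) :
  (forall i, i \in r -> slp_computes A k [:: f i]) ->
  slp_computes A (k.+1 * size r).+1 [:: \prod_(i <- r) f i].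
Proof.
elim: r => [|i r IH] H; first by rewrite big_nil -mpolyC1 muln0; apply: slp_computes_const.
rewrite big_cons /= mulnS; apply: slp_computes_leq (slp_computesM (H i (mem_head _ _)) (IH _)).
  by lia.
by move=> j jr; apply: H; rewrite inE jr orbT.
Qed.

Lemma slp_computes_sum_ord A k m (f : 'I_m -> P) :
  (forall i, slp_computes A k [:: f i]) ->
  slp_computes A (k.+1 * m).+1 [:: \sum_i f i].
Proof.
move=> H; rewrite -[m in (_ * m)%N]card_ord cardE -big_enum /=.
by apply: slp_computes_sum => i _.
Qed.

(** An internal gate with e inputs unfolds into e + 1 steps, an initial 0 or 1 and e binary
    operations: exactly its contribution of one node and e edges to the size. *)
Lemma slp_computes_circuit (C : circuit R n) : circuit_wf C ->
  slp_computes [::] (circuit_size C) (circuit_vals C).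
Proof.
elim/last_ind: C => [|C g IH] wf; first by exists [::].
have wfC : circuit_wf C.
  move=> i ltiC; have := wf i; rewrite size_rcons ltnS => /(_ (ltnW ltiC)).
  by rewrite /= nth_rcons ltiC.
have -> : circuit_size (rcons C g) = (circuit_size C + (size (children g)).+1)%N.
  by rewrite /circuit_size size_rcons -cats1 big_cat big_seq1 /=; lia.
rewrite circuit_vals_rcons.
apply: (@slp_computes_sub [::] [::] (circuit_size C + (size (children g)).+1) _ ([:: gate_val (circuit_vals C) g] ++ circuit_vals C)) => //.
  by move=> x; rewrite mem_rcons.
apply: (slp_computes_trans (W := [:: _]) (IH wfC)); rewrite cats0.
have := wf (size C); rewrite size_rcons ltnSn nth_rcons ltnn eqxx => /(_ isT) /=.
have memv js : all (fun j => j < size C)%N js -> forall j, j \in js ->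
    slp_computes (circuit_vals C) 0 [:: (circuit_vals C)`_j].
  move=> /allP H j /H ltj; apply: slp_computes_mem => x; rewrite inE => /eqP->.
  by rewrite mem_nth // size_circuit_vals.
case: g wf => [i|c|js|js] wf /=.
- by move=> _; apply: slp_computes_var.
- by move=> _; apply: slp_computes_const.
- by case/andP=> _ H; rewrite -[size js]mul1n; apply: slp_computes_sum; apply: memv.
- by case/andP=> _ H; rewrite -[size js]mul1n; apply: slp_computes_prod; apply: memv.
Qed.

(** The factor 3: each step becomes one node with at most two incoming edges. *)
Lemma circuit_of_slp B : slp [::] B ->
  exists C : circuit R n, [/\ circuit_wf C, circuit_vals C = rev B & (circuit_size C <= 3 * size B)%N].
Proof.
elim: B => [|x B IH] /= => [_|[sx /IH[C [wf vC szC]]]].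
  by exists [::]; split=> //; rewrite /circuit_size big_nil.
have sz g : circuit_size (rcons C g) = (circuit_size C + (size (children g)).+1)%N.
  by rewrite /circuit_size size_rcons -cats1 big_cat big_seq1 /=; lia.
have fin g : is_leaf g || (children g != [::]) && all (fun j => j < size C)%N (children g) ->
    gate_val (circuit_vals C) g = x -> (size (children g) <= 2)%N ->
    exists C : circuit R n, [/\ circuit_wf C, circuit_vals C = rev (x :: B) & (circuit_size C <= 3 * (size B).+1)%N].
  move=> wfg gx sg; exists (rcons C g); split; first exact: circuit_wf_rcons.
    by rewrite circuit_vals_rcons gx vC rev_cons.
  by rewrite sz; lia.
case: sx => [[c xE]|[i xE]|[a [b [aB bB xE]]]].
- by apply: (fin (Const n c)).
- by apply: (fin (Var R i)).
have im y : y \in B ++ [::] -> (index y (circuit_vals C) < size C)%N /\ (circuit_vals C)`_(index y (circuit_vals C)) = y.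
  by rewrite cats0 -mem_rev -vC => yB; rewrite -size_circuit_vals index_mem nth_index.
have [ia na] := im _ aB; have [ib nb] := im _ bB.
case: xE => xE.
- apply: (fin (Add R n [:: index a (circuit_vals C); index b (circuit_vals C)])) => //=.
    by rewrite ia ib.
  by rewrite big_cons big_seq1 na nb.
- apply: (fin (Mul R n [:: index a (circuit_vals C); index b (circuit_vals C)])) => //=.
    by rewrite ia ib.
  by rewrite big_cons big_seq1 na nb.
Qed.

Lemma circuit_of_slp_computes k x : slp_computes [::] k [:: x] ->
  exists C : circuit R n, computes C x /\ (circuit_size C <= 3 * k)%N.
Proof.
move=> [B [sB szB xB]]; have [C [wf vC szC]] := circuit_of_slp sB.
exists C; split; last by apply: leq_trans szC _; rewrite leq_mul2l szB.
by split=> //; rewrite vC mem_rev; have := xB x (mem_head _ _); rewrite cats0.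
Qed.

Lemma slp_computes_of_poly_size (h : P) : slp_computes [::] (poly_size h) [:: h].
Proof.
rewrite /poly_size; case: ex_minnP => m /asboolP[C [[wf hC] <-]] _.
by apply: slp_computes_sub (slp_computes_circuit wf) => // x; rewrite inE => /eqP->.
Qed.

End StraightLine.

Section Simulation.
Variables (R R' : comNzRingType) (n n' : nat) (T : {mpoly R[n]} -> seq {mpoly R'[n']}) (k : nat).
Hypotheses (TC : forall c, slp_computes [::] k (T c%:MP))
  (TX : forall i, slp_computes [::] k (T 'X_i))
  (TD : forall a b, slp_computes (T a ++ T b) k (T (a + b)))
  (TM : forall a b, slp_computes (T a ++ T b) k (T (a * b))).

(** The common pattern of the program transformations below: each value x is replaced by the list
    [T x], at cost [k] per operation. *)
Lemma slp_simulation B : slp [::] B -> slp_computes [::] (k * size B) (flatten (map T B)).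
Proof.
elim: B => [|x B IH] /= => [_|[sx /IH cB]]; first by rewrite muln0; apply: slp_computes_mem.
rewrite mulnS addnC; apply: slp_computes_trans cB _; rewrite cats0.
case: sx => [[c ->]|[i ->]|[a [b [aB bB xE]]]].
- by apply: slp_computes_sub (TC c).
- by apply: slp_computes_sub (TX i).
have sub : {subset T a ++ T b <= flatten (map T B)}.
  rewrite !cats0 in aB bB.
  move=> y; rewrite mem_cat => /orP[yT|yT]; apply/flattenP; [exists (T a)|exists (T b)] => //; exact: map_f.
by case: xE => ->; [apply: slp_computes_sub (TD a b)|apply: slp_computes_sub (TM a b)].
Qed.

Lemma slp_computes_simulation m V : slp_computes [::] m V ->
  slp_computes [::] (k * m) (flatten (map T V)).
Proof.
move=> [B [sB szB VB]]; apply: slp_computes_sub (slp_simulation sB) => //.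
  by rewrite leq_mul2l szB orbT.
move=> y /flattenP[_ /mapP[x /VB xB ->] yT]; rewrite cats0 in xB.
by apply/flattenP; exists (T x) => //; apply: map_f.
Qed.

End Simulation.

(** * Transformations of straight-line programs *)

(** Each value travels with its derivative; the 4 is the cost of a product together with its Leibniz
    rule. *)
Lemma slp_computes_derivation (F : fieldType) n (D : {mpoly F[n]} -> {mpoly F[n]}) k f :
  degree_derivation D -> slp_computes [::] k [:: f] -> slp_computes [::] (4 * k) [:: f; D f].
Proof.
move=> [[DD DM] DC DX _] cf.
apply: (@slp_computes_simulation _ _ _ _ (fun x => [:: x; D x]) 4 _ _ _ _ k [:: f]) => //=.
- move=> c; have [c' ->] := DC c.
  by apply: (@slp_computes_leq _ _ _ (1 + 1)) => //; apply: (slp_computes_cat (V := [:: _]));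
    apply: slp_computes_const.
- move=> i; have [c' ->] := DX i.
  apply: (@slp_computes_leq _ _ _ (1 + 1)) => //; apply: (slp_computes_cat (V := [:: _])).
    exact: slp_computes_var.
  exact: slp_computes_const.
- move=> a b; rewrite DD.
  by apply: (@slp_computes_leq _ _ _ (1 + 1)) => //; apply: (slp_computes_cat (V := [:: _]));
    apply: (@slp_computesD _ _ _ 0 0); apply: slp_computes_in; rewrite !inE eqxx ?orbT.
- move=> a b; rewrite DM.
  apply: (@slp_computes_leq _ _ _ (1 + 3)) => //; apply: (slp_computes_cat (V := [:: _])).
    by apply: (@slp_computesM _ _ _ 0 0); apply: slp_computes_in; rewrite !inE eqxx ?orbT.
  by apply: (@slp_computesD _ _ _ 1 1); apply: (@slp_computesM _ _ _ 0 0);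
    apply: slp_computes_in; rewrite !inE eqxx ?orbT.
Qed.

Lemma slp_computes_translate (R S : comNzRingType) (j : {rmorphism R -> S}) n (v : 'I_n -> S) k f :
  slp_computes [::] k [:: f] ->
  slp_computes [::] (3 * k) [:: mmap (@mpolyC n S \o j) (fun i => 'X_i + (v i)%:MP) f].
Proof.
move=> cf.
apply: (@slp_computes_simulation _ _ _ _ (fun x => [:: mmap (@mpolyC n S \o j) (fun i => 'X_i + (v i)%:MP) x]) 3 _ _ _ _ k [:: f]) => //=.
- by move=> c; rewrite mmapC; apply: slp_computes_leq (slp_computes_const _ _).
- move=> i; rewrite mmapU; apply: (@slp_computesD _ _ _ 1 1).
    exact: slp_computes_var.
  exact: slp_computes_const.
- move=> a b; rewrite rmorphD; apply: (@slp_computes_leq _ _ _ 1) => //.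
  by apply: (@slp_computesD _ _ _ 0 0); apply: slp_computes_in; rewrite !inE eqxx ?orbT.
- move=> a b; rewrite rmorphM; apply: (@slp_computes_leq _ _ _ 1) => //.
  by apply: (@slp_computesM _ _ _ 0 0); apply: slp_computes_in; rewrite !inE eqxx ?orbT.
Qed.

(** * Order of vanishing at the origin and homogeneous components *)

Section LowOrder.
Variable R : comNzRingType.
Implicit Types (p q : {poly R}).

Definition low_order t p : Prop := forall i, (i < t)%N -> p`_i = 0.

Lemma low_orderD t p q : low_order t p -> low_order t q -> low_order t (p + q).
Proof. by move=> vp vq i it; rewrite coefD vp // vq // addr0. Qed.

Lemma low_orderB t p q : low_order t p -> low_order t q -> low_order t (p - q).
Proof. by move=> vp vq i it; rewrite coefB vp // vq // subr0. Qed.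

Lemma low_orderM s t p q : low_order s p -> low_order t q -> low_order (s + t) (p * q).
Proof.
move=> vp vq i it; rewrite coefM big1 // => l _.
have [ls|sl] := ltnP l s; first by rewrite vp // mul0r.
by rewrite vq ?mulr0 //; move: (ltn_ord l); lia.
Qed.

Lemma low_order_leq s t p : (s <= t)%N -> low_order t p -> low_order s p.
Proof. by move=> st vx i si; apply: vx; apply: leq_trans st. Qed.

Lemma low_order_zero t : low_order t (0 : {poly R}).
Proof. by move=> i _; rewrite coef0. Qed.

Lemma low_order_coef t p q i : low_order t (p - q) -> (i < t)%N -> p`_i = q`_i.
Proof. by move=> v it; apply/eqP; rewrite -subr_eq0 -coefB v. Qed.

End LowOrder.

(* Naming the instance keeps unification from unfolding the structures of
   mpoly in the ring {poly {mpoly K[n]}}. *)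
Definition mpoly_ring (K : comNzRingType) (n : nat) : comNzRingType := {mpoly K[n]}.

Section Homogeneous.
Variables (K : comNzRingType) (n : nat).
Local Notation P := {mpoly K[n]}.
Implicit Types (x y : {mpoly K[n]}).

Local Notation PR := (mpoly_ring K n).
Let jP : {rmorphism K -> PR} := @mpolyC n K.

(* (dilate x)`_i is the homogeneous component of degree i of x. *)
Definition dilate : P -> {poly PR} := line jP (fun=> 0) (fun i => 'X_i : P).
HB.instance Definition _ := GRing.RMorphism.on dilate.

Lemma dilateC c : dilate c%:MP = (c%:MP)%:P. Proof. exact: lineC. Qed.
Lemma dilateX i : dilate 'X_i = ('X_i)%:P * 'X.
Proof. by apply: etrans (lineX _ _ _ _) _; rewrite add0r. Qed.
Lemma dilateD x y : dilate (x + y) = dilate x + dilate y. Proof. exact: rmorphD. Qed.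
Lemma dilateB x y : dilate (x - y) = dilate x - dilate y. Proof. exact: rmorphB. Qed.
Lemma dilateM x y : dilate (x * y) = dilate x * dilate y. Proof. exact: rmorphM. Qed.

Lemma dilate_sum d x : (msize x <= d)%N -> x = \sum_(i < d) (dilate x)`_i.
Proof.
move=> sx; have sd := leq_trans (size_line jP (fun=> 0) (fun i => 'X_i : P) x) sx.
have E : (dilate x).[1] = x.
  apply: etrans (horner_line _ _ _ _ _) _.
  apply: (@mpoly_rmorph_eq _ _ _ (mmap jP _) idfun) => [c|i] /=; first exact: (mmapC _ jP).
  by rewrite [LHS](mmapU jP) add0r mulr1.
apply: etrans (esym E) _; rewrite (horner_coef_wide 1 sd).
by apply: eq_bigr => i _; rewrite expr1n mulr1.
Qed.

Lemma dilate_coef0 x : (dilate x)`_0 = (x.@[fun=> 0])%:MP.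
Proof.
rewrite -horner_coef0; apply: etrans (horner_line _ _ _ _ _) _.
apply: (@mpoly_rmorph_eq _ _ _ (mmap jP _) (jP \o meval _)) => [c|i] /=.
  by apply: etrans (mmapC _ jP _) _; rewrite mevalC.
by rewrite [LHS](mmapU jP) mevalXU mpolyC0 mulr0 add0r.
Qed.

(** The component of degree i of a product involves only components of degree at most i, so the
    possibly huge degrees above [d] are never touched. A product costs [d.+1] convolutions of at
    most 2d + 3 steps. *)
Lemma slp_computes_dilate d k (V : seq P) : slp_computes [::] k V ->
  slp_computes [::] ((2 * d + 3) * d.+1 * k) (flatten [seq [seq (dilate x)`_i | i <- iota 0 d.+1] | x <- V]).
Proof.
apply: slp_computes_simulation.
- move=> c; apply: (@slp_computes_leq _ _ _ (1 * size (iota 0 d.+1))); first by rewrite size_iota leq_mul2r addn3 orbT.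
  apply: slp_computes_seq => i _; rewrite dilateC coefC.
  by case: eqP => _; rewrite -?mpolyC0; apply: slp_computes_const.
- move=> c; apply: (@slp_computes_leq _ _ _ (1 * size (iota 0 d.+1))); first by rewrite size_iota leq_mul2r addn3 orbT.
  apply: slp_computes_seq => i _; rewrite dilateX coefCM coefX.
  by case: eqP => _; rewrite ?mulr1 ?mulr0 -?mpolyC0; [apply: slp_computes_var|apply: slp_computes_const].
- move=> a b; apply: (@slp_computes_leq _ _ _ (1 * size (iota 0 d.+1))); first by rewrite size_iota leq_mul2r addn3 orbT.
  apply: slp_computes_seq => i id; rewrite dilateD coefD.
  have mem x : (dilate x)`_i \in [seq (dilate x)`_l | l <- iota 0 d.+1] by apply/mapP; exists i.
  apply: (@slp_computesD _ _ _ 0 0); first by apply: slp_computes_in_catl; apply: mem.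
  by apply: slp_computes_in_catr; apply: mem.
- move=> a b; apply: (@slp_computes_leq _ _ _ ((2 * d + 3) * size (iota 0 d.+1))); first by rewrite size_iota.
  apply: slp_computes_seq => i; rewrite mem_iota add0n ltnS => /andP[_ id]; rewrite dilateM coefM.
  apply: (@slp_computes_leq _ _ _ (2 * i.+1).+1); first by lia.
  apply: slp_computes_sum_ord => l.
  have li : (l <= i)%N by rewrite -ltnS.
  have mem x e : (e <= i)%N -> (dilate x)`_e \in [seq (dilate x)`_l | l <- iota 0 d.+1].
    by move=> ei; apply/mapP; exists e => //; rewrite mem_iota; lia.
  apply: (@slp_computesM _ _ _ 0 0); first by apply: slp_computes_in_catl; apply: mem.
  by apply: slp_computes_in_catr; apply: mem; rewrite leq_subr.
Qed.

Definition vanish_order t x : Prop := low_order t (dilate x).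

Lemma vanish_orderD t x y : vanish_order t x -> vanish_order t y -> vanish_order t (x + y).
Proof. by move=> vx vy; rewrite /vanish_order dilateD; exact (low_orderD vx vy). Qed.

Lemma vanish_orderB t x y : vanish_order t x -> vanish_order t y -> vanish_order t (x - y).
Proof. by move=> vx vy; rewrite /vanish_order dilateB; exact (low_orderB vx vy). Qed.

Lemma vanish_orderM s t x y : vanish_order s x -> vanish_order t y -> vanish_order (s + t) (x * y).
Proof. by move=> vx vy; rewrite /vanish_order dilateM; exact (low_orderM vx vy). Qed.

Lemma vanish_orderMl t x y : vanish_order t y -> vanish_order t (x * y).
Proof. by move=> vy; exact (@vanish_orderM 0 t x y (fun i (h : (i < 0)%N) => False_ind _ (notF h)) vy). Qed.

Lemma vanish_order_leq s t x : (s <= t)%N -> vanish_order t x -> vanish_order s x.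
Proof. by move=> st vx; exact (low_order_leq st vx). Qed.

Lemma vanish_order1 x : x.@[fun=> 0] = 0 -> vanish_order 1 x.
Proof. by move=> x0 [|i] // _; rewrite [LHS]dilate_coef0 x0 mpolyC0. Qed.

Lemma vanish_order_sum (I : Type) (r : seq I) (f : I -> P) t :
  (forall i, vanish_order t (f i)) -> vanish_order t (\sum_(i <- r) f i).
Proof.
move=> H; elim: r => [|i r IH]; last by rewrite big_cons; exact (vanish_orderD (H i) IH).
by rewrite big_nil /vanish_order (rmorph0 dilate); exact (@low_order_zero _ t).
Qed.

Lemma vanish_order_truncate d x y : vanish_order d (x - y) -> (msize y <= d)%N ->
  y = \sum_(i < d) (dilate x)`_i.
Proof.
move=> v sy; apply: etrans (dilate_sum sy) _; apply: eq_bigr => i _.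
rewrite /vanish_order dilateB in v; exact (esym (low_order_coef v (ltn_ord i))).
Qed.

End Homogeneous.

(** * Newton iteration *)

(** With [am], [al], [b0] the values at the origin, every term on the right is an error times
    something that vanishes at the origin, or a product of two errors. This is where an order is
    gained. *)
Lemma newton_defect (R : comNzRingType) (a b l m c e1 e2 e3 am al b0 : R) :
  a * l * m - b * c = 0 ->
  a * (l + e1) * (m + e2) - b * (c + e3) - (am * e1 + al * e2 - b0 * e3) =
  (a * m - am) * e1 + (a * l - al) * e2 + (a * e1) * e2 - (b - b0) * e3.
Proof.
move=> E; have -> : a * (l + e1) * (m + e2) = a * l * m + a * m * e1 + a * l * e2 + a * e1 * e2 by ring.
have -> : a * l * m = b * c by apply/eqP; rewrite -subr_eq0 E.
by ring.
Qed.

Section Newton.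
Variables (K : comNzRingType) (n m M : nat).
Local Notation P := {mpoly K[n]}.
Variables (L1 L2 L3 : 'I_m -> 'I_M -> K) (lam mu : 'I_M -> K) (a b : 'I_M -> P).
Implicit Types (z e : 'I_m -> P).

Definition lin (L : 'I_m -> 'I_M -> K) z j : P := \sum_i (L i j)%:MP * z i.

(** The equation at the j-th sample value. [lam] and [mu] carry the known leading terms of u and q;
    [z] lists their lower coefficients and all coefficients of N. *)
Definition residual z j : P :=
  a j * ((lam j)%:MP + lin L1 z j) * ((mu j)%:MP + lin L2 z j) - b j * lin L3 z j.

Definition ev0 : P -> K := meval (fun=> 0).
HB.instance Definition _ := GRing.RMorphism.on ev0.

Lemma ev0C c : ev0 c%:MP = c. Proof. exact: mevalC. Qed.
Lemma ev0D x y : ev0 (x + y) = ev0 x + ev0 y. Proof. exact: mevalD. Qed.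
Lemma ev0B x y : ev0 (x - y) = ev0 x - ev0 y. Proof. exact: mevalB. Qed.
Lemma ev0M x y : ev0 (x * y) = ev0 x * ev0 y. Proof. exact: mevalM. Qed.

Definition lin0 (L : 'I_m -> 'I_M -> K) z j : K := \sum_i L i j * ev0 (z i).

(** The derivative of the j-th residual in the i-th unknown, taken at the origin of the variables
    and hence a scalar. *)
Definition jacobian z i j : K :=
  ev0 (a j) * (L1 i j * (mu j + lin0 L2 z j) + (lam j + lin0 L1 z j) * L2 i j)
  - ev0 (b j) * L3 i j.

Variables (zs : 'I_m -> P) (S : 'I_M -> 'I_m -> K) (d : nat).
Hypothesis zs_root : forall j, residual zs j = 0.
Hypothesis S_inv : forall i k, \sum_j jacobian zs i j * S j k = (i == k)%:R.

Definition newton z i : P := z i - \sum_j (S j i)%:MP * residual z j.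

Lemma ev0_lin L z j : ev0 (lin L z j) = lin0 L z j.
Proof.
rewrite /lin /lin0 rmorph_sum /=; apply: eq_bigr => i _.
by rewrite rmorphM /= [ev0 _%:MP]mevalC.
Qed.

Lemma linD L z e j : lin L (fun i => z i + e i) j = lin L z j + lin L e j.
Proof. by rewrite /lin -big_split; apply: eq_bigr => i _; rewrite mulrDr. Qed.

Lemma lin_vanish L e j t : (forall i, vanish_order t (e i)) -> vanish_order t (lin L e j).
Proof. by move=> ve; apply: vanish_order_sum => i; exact (vanish_orderMl _ (ve i)). Qed.

Lemma vanish_order_ev0 (x : P) c : ev0 x = c -> vanish_order 1 (x - c%:MP).
Proof. by move=> <-; apply: vanish_order1; rewrite mevalB mevalC subrr. Qed.

(** With e the error and J the Jacobian, the new error is e - S(J e) minus [S] applied to the defect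
    of linearization. The first difference vanishes by [S_inv], and the defect has order t + 1. *)
Lemma newton_gain t z : (0 < t)%N -> (forall i, vanish_order t (z i - zs i)) ->
  forall i, vanish_order t.+1 (newton z i - zs i).
Proof.
move=> t0 vz k; pose e i := z i - zs i.
have zE i : z i = zs i + e i by rewrite /e addrC subrK.
pose l j := (lam j)%:MP + lin L1 zs j; pose mm j := (mu j)%:MP + lin L2 zs j.
pose Je j := \sum_i (jacobian zs i j)%:MP * e i.
pose am j := ev0 (a j) * (mu j + lin0 L2 zs j).
pose al j := ev0 (a j) * (lam j + lin0 L1 zs j).
have JeE j : Je j = (am j)%:MP * lin L1 e j + (al j)%:MP * lin L2 e j - (ev0 (b j))%:MP * lin L3 e j.
  rewrite /Je /lin !mulr_sumr -big_split -sumrB; apply: eq_bigr => i _ /=.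
  rewrite !mulrA -!mpolyCM -mulrDl -mulrBl -mpolyCD -mpolyCB; congr (_%:MP * _).
  by rewrite /jacobian /am /al; ring.
have lz L j : lin L z j = lin L zs j + lin L e j.
  by rewrite -linD /lin; apply: eq_bigr => i _; rewrite zE.
have defect j : vanish_order t.+1 (residual z j - Je j).
  have root : a j * l j * mm j - b j * lin L3 zs j = 0 by rewrite -(zs_root j).
  rewrite JeE /residual !lz !addrA -/(l j) -/(mm j) (newton_defect _ _ _ _ _ _ root).
  have ve L : vanish_order t (lin L e j) by apply: lin_vanish.
  have v1 x c : ev0 x = c -> vanish_order 1 (x - c%:MP) by apply: vanish_order_ev0.
  rewrite -add1n; apply: vanish_orderB; last first.
    exact (vanish_orderM (v1 _ _ erefl) (ve _)).
  apply: vanish_orderD.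
    apply: vanish_orderD.
      apply: vanish_orderM (ve _); apply: v1.
      by rewrite rmorphM rmorphD /= ev0_lin [ev0 _%:MP]mevalC.
    apply: vanish_orderM (ve _); apply: v1.
    by rewrite rmorphM rmorphD /= ev0_lin [ev0 _%:MP]mevalC.
  (* The quadratic term: it reaches order t + 1 because t > 0. *)
  apply: vanish_orderM (ve _); apply: vanish_order_leq t0 _.
  exact (vanish_orderMl _ (ve _)).
have eE : e k = \sum_j (S j k)%:MP * Je j.
  rewrite /Je; under eq_bigr do rewrite mulr_sumr.
  have coef i : \sum_j (S j k)%:MP * ((jacobian zs i j)%:MP * e i) = (i == k)%:R%:MP * e i.
    rewrite -S_inv raddf_sum /= mulr_suml; apply: eq_bigr => j _.
    by rewrite mulrA -mpolyCM; congr (_%:MP * _); apply: mulrC.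
  rewrite exchange_big /= (bigD1 k) //= coef eqxx mpolyC1 mul1r big1 ?addr0 // => i ik.
  by rewrite coef (negbTE ik) mpolyC0 mul0r.
have -> : newton z k - zs k = 0 - \sum_j (S j k)%:MP * (residual z j - Je j).
  under [in RHS]eq_bigr do rewrite mulrBr.
  by rewrite sumrB -eE /newton /e sub0r opprB addrAC.
apply: vanish_orderB; last by apply: vanish_order_sum => j; exact (vanish_orderMl _ (defect j)).
by rewrite /vanish_order (rmorph0 (@dilate K n)); exact (@low_order_zero _ _).
Qed.

(** The start consists of the constant terms of the solution, supplied as constants of the circuit
    and correct to order 1. *)
Fixpoint newton_iter t : 'I_m -> P :=
  if t is t'.+1 then newton (newton_iter t') else fun i => (ev0 (zs i))%:MP.

Lemma newton_iter_vanish t i : vanish_order t.+1 (newton_iter t i - zs i).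
Proof.
elim: t i => [|t IH] i; last exact (newton_gain (ltn0Sn t) IH i).
by apply: vanish_order1; rewrite mevalB mevalC subrr.
Qed.

(** [M] residuals, each built on three linear forms in [m] unknowns, then [m] corrections, each
    combining [M] residuals. *)
Definition newton_cost : nat := ((9 * m + 13) * M + (3 * M + 4) * m)%N.

Lemma slp_computes_newton A z : (forall j, a j \in A /\ b j \in A) -> (forall i, z i \in A) ->
  slp_computes A newton_cost (codom (newton z)).
Proof.
move=> abA zA.
have clin A' L j : (forall i, z i \in A') -> slp_computes A' (3 * m).+1 [:: lin L z j].
  move=> zA'; apply: slp_computes_sum_ord => i.
  apply: (@slp_computesM _ _ _ 1 0); first exact: slp_computes_const.
  exact: slp_computes_in.
have cres j : slp_computes A (9 * m + 13) [:: residual z j].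
  have [aA bA] := abA j.
  apply: slp_computes_leq (slp_computesB (slp_computesM (slp_computesM (slp_computes_in aA)
    (slp_computesD (slp_computes_const _ _) (clin _ _ _ zA))) 
    (slp_computesD (slp_computes_const _ _) (clin _ _ _ zA)))
    (slp_computesM (slp_computes_in bA) (clin _ _ _ zA))).
  by lia.
apply: slp_computes_bind (slp_computes_fam cres) _.
apply: slp_computes_fam => i.
have zi : z i \in codom (residual z) ++ A by rewrite mem_cat zA orbT.
apply: slp_computes_leq (slp_computesB (slp_computes_in zi) (slp_computes_sum_ord (k := 2) _)).
  by lia.
move=> j; apply: (@slp_computesM _ _ _ 1 0); first exact: slp_computes_const.
by apply: slp_computes_in; rewrite mem_cat codom_f.
Qed.

Lemma slp_computes_newton_iter A t : (forall j, a j \in A /\ b j \in A) ->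
  slp_computes A (m + t * newton_cost) (codom (newton_iter t)).
Proof.
move=> abA; elim: t => [|t IH].
  rewrite mul0n addn0 -[X in slp_computes _ X]mul1n; apply: slp_computes_fam => i.
  exact: slp_computes_const.
rewrite mulSn addnCA addnC; apply: slp_computes_bind IH _.
apply: slp_computes_newton => [j|i]; last by rewrite mem_cat codom_f.
by have [aA bA] := abA j; rewrite !mem_cat aA bA !orbT.
Qed.

(** After [d] steps the error has order d + 1, beyond the degree of [zs i], so truncating the
    iterate at degree [d] returns [zs i] exactly, however large the degree of the iterate. *)
Lemma slp_computes_root k0 i : (msize (zs i) <= d.+1)%N ->
  slp_computes [::] k0 (codom a ++ codom b) ->
  slp_computes [::] ((2 * d + 3) * d.+1 * (k0 + (m + d * newton_cost)) + d.+2) [:: zs i].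
Proof.
move=> sz cab.
have cz : slp_computes [::] (k0 + (m + d * newton_cost)) (codom (newton_iter d)).
  apply: slp_computes_bind cab _; apply: slp_computes_newton_iter => j.
  by rewrite !mem_cat !codom_f orbT.
apply: slp_computes_bind (slp_computes_dilate d cz) _.
have := vanish_order_truncate (newton_iter_vanish (t := d) i) sz => ->.
rewrite -[X in slp_computes _ X.+1](mul1n d.+1).
apply: slp_computes_sum_ord => l; apply: slp_computes_in; rewrite cats0.
apply/flattenP; exists [seq (dilate (newton_iter d i))`_l | l <- iota 0 d.+1].
  by apply/mapP; exists (newton_iter d i) => //; apply: codom_f.
by apply/mapP; exists (val l) => //; rewrite mem_iota add0n leq0n /=.
Qed.

End Newton.

(** * Lifting a factor from a line *)

(** The sampled polynomial has degree at most 2d and 2d + 1 zeros, so it is zero. As [N] is prime to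
    [U * Q], the latter divides [Vu * Q + U * Vq], which has smaller degree and so vanishes; then
    [U] divides [Vu], again of smaller degree. The bounds on [Vu] and [Vq] reflect the fixed leading
    coefficients. *)
Lemma pade_injective (K : fieldType) (U Q N Vu Vq Vn : {poly K}) m1 m2 d (y : 'I_(2 * d).+1 -> K) :
  injective y -> coprimep U Q -> coprimep N U -> coprimep N Q ->
  size U = m1.+1 -> size Q = m2.+1 -> (m1 + m2 <= d)%N -> (size N <= d.+1)%N ->
  (size Vu <= m1)%N -> (size Vq <= m2)%N -> (size Vn <= d.+1)%N ->
  (forall j, (N * (Vu * Q + U * Vq) - Vn * (U * Q)).[y j] = 0) ->
  [/\ Vu = 0, Vq = 0 & Vn = 0].
Proof.
move=> yI cUQ cNU cNQ sU sQ m12 sN sVu sVq sVn root.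
have U0 : U != 0 by rewrite -size_poly_eq0 sU.
have Q0 : Q != 0 by rewrite -size_poly_eq0 sQ.
set W := Vu * Q + U * Vq; have sW : (size W <= m1 + m2)%N.
  apply: leq_trans (size_polyD _ _) _; rewrite geq_max; apply/andP; split;
    apply: leq_trans (size_polyMleq _ _) _; rewrite ?sU ?sQ; lia.
have E0 : N * W - Vn * (U * Q) = 0.
  apply: (@roots_geq_poly_eq0 _ _ (codom y)).
  - by apply/allP => _ /codomP[j ->]; apply/eqP/root.
  - by rewrite map_inj_uniq ?enum_uniq.
  - rewrite size_codom card_ord; apply: leq_trans (size_polyD _ _) _; rewrite size_polyN geq_max.
    apply/andP; split; apply: leq_trans (size_polyMleq _ _) _; rewrite -subn1 leq_subLR.
      by apply: leq_trans (leq_add sN sW) _; lia.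
    by apply: leq_trans (leq_add sVn (leqnn _)) _; rewrite size_mul // sU sQ; lia.
have W0 : W = 0.
  apply/eqP; apply: contraT => W0.
  have : U * Q %| W.
    rewrite -(@Gauss_dvdpr _ _ N); last by rewrite coprimep_sym coprimepMr cNU.
    by move/eqP: E0; rewrite subr_eq0 => /eqP->; apply: dvdp_mulIr.
  by move/(dvdp_leq W0)/leq_trans/(_ sW); rewrite size_mul // sU sQ; lia.
have Vn0 : Vn = 0.
  apply/eqP; move/eqP: E0; rewrite W0 mulr0 sub0r oppr_eq0 !mulf_eq0.
  by rewrite (negbTE U0) (negbTE Q0) !orbF.
have Vu0 : Vu = 0.
  apply/eqP; apply: contraT => Vu0.
  have : U %| Vu.
    rewrite -(@Gauss_dvdpl _ _ Q) //.
    by move/eqP: W0; rewrite addr_eq0 => /eqP->; rewrite -mulrN; apply: dvdp_mulIl.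
  by move/(dvdp_leq Vu0)/leq_trans/(_ sVu); rewrite sU; lia.
split=> //; apply/eqP; move/eqP: W0; rewrite /W Vu0 mul0r add0r mulf_eq0.
by rewrite (negbTE U0).
Qed.

Section Blocks.
Variables (T : Type) (m1 m2 m3 : nat) (f1 : 'I_m1 -> T) (f2 : 'I_m2 -> T) (f3 : 'I_m3 -> T).

Definition blocks (i : 'I_(m1 + (m2 + m3))) : T :=
  match split i with
  | inl k => f1 k
  | inr i' => match split i' with inl k => f2 k | inr k => f3 k end
  end.

Lemma blocks1 k : blocks (lshift _ k) = f1 k.
Proof. by rewrite /blocks (unsplitK (inl k)). Qed.
Lemma blocks2 k : blocks (rshift _ (lshift _ k)) = f2 k.
Proof. by rewrite /blocks (unsplitK (inr (lshift _ k))) (unsplitK (inl k)). Qed.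
Lemma blocks3 k : blocks (rshift _ (rshift _ k)) = f3 k.
Proof. by rewrite /blocks (unsplitK (inr (rshift _ k))) (unsplitK (inr k)). Qed.

End Blocks.

Lemma sum_blocks (R : nmodType) m1 m2 m3 (F : 'I_(m1 + (m2 + m3)) -> R) :
  \sum_i F i = \sum_k F (lshift _ k) + (\sum_k F (rshift _ (lshift _ k)) + \sum_k F (rshift _ (rshift _ k))).
Proof. by rewrite big_split_ord /= big_split_ord. Qed.

Section Lift.
Variables (K : fieldType) (n d m1 m2 : nat).
Local Notation P := {mpoly K[n]}.
Local Notation M := (2 * d).+1.
Variables (cu : 'I_m1 -> P) (cq : 'I_m2 -> P) (cn : 'I_d.+1 -> P) (lu lq : K) (y : 'I_M -> K).
Variables (a b : 'I_M -> P) (U Q N : {poly K}).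

Let evalu j : P := (lu * y j ^+ m1)%:MP + \sum_(k < m1) (y j ^+ k)%:MP * cu k.
Let evalq j : P := (lq * y j ^+ m2)%:MP + \sum_(k < m2) (y j ^+ k)%:MP * cq k.
Let evaln j : P := \sum_(k < d.+1) (y j ^+ k)%:MP * cn k.

Hypothesis eqs : forall j, a j * evalu j * evalq j = b j * evaln j.
Hypotheses (sU : size U = m1.+1) (sQ : size Q = m2.+1) (sN : (size N <= d.+1)%N).
Hypotheses (Uk : forall k : 'I_m1, U`_k = ev0 (cu k)) (Um : U`_m1 = lu).
Hypotheses (Qk : forall k : 'I_m2, Q`_k = ev0 (cq k)) (Qm : Q`_m2 = lq).
Hypotheses (Nk : forall k : 'I_d.+1, N`_k = ev0 (cn k)).
Hypotheses (yI : injective y) (m12 : (m1 + m2 <= d)%N) (b0 : forall j, ev0 (b j) != 0).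
Hypotheses (cUQ : coprimep U Q) (cNU : coprimep N U) (cNQ : coprimep N Q).

Let L1 (i : 'I_(m1 + (m2 + d.+1))) j : K := blocks (fun k => y j ^+ k) (fun=> 0) (fun=> 0) i.
Let L2 (i : 'I_(m1 + (m2 + d.+1))) j : K := blocks (fun=> 0) (fun k => y j ^+ k) (fun=> 0) i.
Let L3 (i : 'I_(m1 + (m2 + d.+1))) j : K := blocks (fun=> 0) (fun=> 0) (fun k => y j ^+ k) i.
Let lam j := lu * y j ^+ m1.
Let mu j := lq * y j ^+ m2.
Let zs : 'I_(m1 + (m2 + d.+1)) -> P := blocks cu cq cn.

Let sum_zero (R : nzRingType) k (F : 'I_k -> R) : (forall i, F i = 0) -> \sum_i F i = 0.
Proof. by move=> F0; apply: big1. Qed.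

Let lin1 j : lin L1 zs j = \sum_(k < m1) (y j ^+ k)%:MP * cu k.
Proof.
rewrite /lin sum_blocks [X in _ + (X + _)]sum_zero => [|k]; last by rewrite /L1 blocks2 mpolyC0 mul0r.
rewrite [X in _ + (_ + X)]sum_zero ?addr0 => [|k]; last by rewrite /L1 blocks3 mpolyC0 mul0r.
by apply: eq_bigr => k _; rewrite /L1 /zs !blocks1.
Qed.

Let lin2 j : lin L2 zs j = \sum_(k < m2) (y j ^+ k)%:MP * cq k.
Proof.
rewrite /lin sum_blocks [X in X + _]sum_zero => [|k]; last by rewrite /L2 blocks1 mpolyC0 mul0r.
rewrite [X in _ + (_ + X)]sum_zero ?addr0 ?add0r => [|k]; last by rewrite /L2 blocks3 mpolyC0 mul0r.
by apply: eq_bigr => k _; rewrite /L2 /zs !blocks2.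
Qed.

Let lin3 j : lin L3 zs j = \sum_(k < d.+1) (y j ^+ k)%:MP * cn k.
Proof.
rewrite /lin sum_blocks [X in X + _]sum_zero => [|k]; last by rewrite /L3 blocks1 mpolyC0 mul0r.
rewrite [X in _ + (X + _)]sum_zero ?addr0 ?add0r => [|k]; last by rewrite /L3 blocks2 mpolyC0 mul0r.
by apply: eq_bigr => k _; rewrite /L3 /zs !blocks3.
Qed.

Let zs_root j : residual L1 L2 L3 lam mu a b zs j = 0.
Proof. by rewrite /residual lin1 lin2 lin3 [X in X - _]eqs subrr. Qed.

Let ev0_sum k (c : 'I_k -> P) j :
  ev0 (\sum_(i < k) (y j ^+ i)%:MP * c i) = \sum_(i < k) ev0 (c i) * y j ^+ i.
Proof.
rewrite rmorph_sum /=; apply: eq_bigr => i _.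
by rewrite rmorphM /= [ev0 _%:MP]mevalC mulrC.
Qed.

Let hU j : lam j + lin0 L1 zs j = U.[y j].
Proof.
rewrite -ev0_lin lin1 ev0_sum (@horner_coef_wide _ m1.+1) ?sU // big_ord_recr /= Um addrC.
by congr (_ + _); apply: eq_bigr => k _; rewrite Uk.
Qed.

Let hQ j : mu j + lin0 L2 zs j = Q.[y j].
Proof.
rewrite -ev0_lin lin2 ev0_sum (@horner_coef_wide _ m2.+1) ?sQ // big_ord_recr /= Qm addrC.
by congr (_ + _); apply: eq_bigr => k _; rewrite Qk.
Qed.

Let hN j : lin0 L3 zs j = N.[y j].
Proof.
by rewrite -ev0_lin lin3 ev0_sum (horner_coef_wide _ sN); apply: eq_bigr => k _; rewrite Nk.
Qed.

Let eqs0 j : ev0 (a j) * U.[y j] * Q.[y j] = ev0 (b j) * N.[y j].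
Proof.
have := congr1 (@ev0 K n) (zs_root j).
rewrite /residual ev0B !ev0M !ev0D !ev0C !ev0_lin hU hQ hN => E.
by apply/eqP; rewrite -subr_eq0 E.
Qed.

(** A vector killed by the Jacobian is read as perturbations of [U], [Q] and [N], to which
    [pade_injective] applies. *)
Let jac_inj (v : 'rV[K]_(m1 + (m2 + d.+1))) :
  (forall j, \sum_i v 0 i * jacobian L1 L2 L3 lam mu a b zs i j = 0) -> v = 0.
Proof.
move=> vJ.
(* The [None] branch is out of range. Its dummy index lies in the third block, the only one known to
   be nonempty. *)
pose Vu := \poly_(k < m1) v 0 (if (insub k : option 'I_m1) is Some k' then lshift _ k' else rshift _ (rshift _ ord0)).
pose Vq := \poly_(k < m2) v 0 (if (insub k : option 'I_m2) is Some k' then rshift _ (lshift _ k') else rshift _ (rshift _ ord0)).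
pose Vn := \poly_(k < d.+1) v 0 (rshift _ (rshift _ (inord k))).
have VuE x : Vu.[x] = \sum_k v 0 (lshift _ k) * x ^+ k.
  by rewrite horner_poly; apply: eq_bigr => k _; rewrite valK.
have VqE x : Vq.[x] = \sum_k v 0 (rshift _ (lshift _ k)) * x ^+ k.
  by rewrite horner_poly; apply: eq_bigr => k _; rewrite valK.
have VnE x : Vn.[x] = \sum_k v 0 (rshift _ (rshift _ k)) * x ^+ k.
  by rewrite horner_poly; apply: eq_bigr => k _; rewrite inord_val.
have [||||Vu0 Vq0 Vn0] := @pade_injective K U Q N Vu Vq Vn m1 m2 d y yI cUQ cNU cNQ sU sQ m12 sN.
- exact: size_poly.
- exact: size_poly.
- exact: size_poly.
- move=> j; have jE i : jacobian L1 L2 L3 lam mu a b zs i j =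
      ev0 (a j) * (L1 i j * Q.[y j] + U.[y j] * L2 i j) - ev0 (b j) * L3 i j.
    by rewrite /jacobian hU hQ.
  have := vJ j; rewrite sum_blocks.
  have -> : \sum_k v 0 (lshift _ k) * jacobian L1 L2 L3 lam mu a b zs (lshift _ k) j
      = ev0 (a j) * Q.[y j] * Vu.[y j].
    rewrite VuE mulr_sumr; apply: eq_bigr => k _; rewrite jE /L1 /L2 /L3 !blocks1; move: (y j ^+ k) (U.[_]) (Q.[_]) (ev0 _) (ev0 _) (v 0 _) => t u q x w c; ring.
  have -> : \sum_k v 0 (rshift _ (lshift _ k)) * jacobian L1 L2 L3 lam mu a b zs (rshift _ (lshift _ k)) j
      = ev0 (a j) * U.[y j] * Vq.[y j].
    rewrite VqE mulr_sumr; apply: eq_bigr => k _; rewrite jE /L1 /L2 /L3 !blocks2; move: (y j ^+ k) (U.[_]) (Q.[_]) (ev0 _) (ev0 _) (v 0 _) => t u q x w c; ring.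
  have -> : \sum_k v 0 (rshift _ (rshift _ k)) * jacobian L1 L2 L3 lam mu a b zs (rshift _ (rshift _ k)) j
      = - ev0 (b j) * Vn.[y j].
    rewrite VnE mulr_sumr; apply: eq_bigr => k _; rewrite jE /L1 /L2 /L3 !blocks3; move: (y j ^+ k) (U.[_]) (Q.[_]) (ev0 _) (ev0 _) (v 0 _) => t u q x w c; ring.
  move=> E; apply: (mulfI (b0 j)); rewrite mulr0 !(hornerD, hornerN, hornerM).
  have := eqs0 j; move: E; set X := ev0 (a j); set Y := ev0 (b j).
  move: (U.[_]) (Q.[_]) (N.[_]) (Vu.[_]) (Vq.[_]) (Vn.[_]) => u q w vu vq vn E E'.
  (* After multiplication by the values of [U] and [Q], the equation [eqs0] eliminates [X], the
     value of [a j] at the origin. *)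
  have -> : Y * (w * (vu * q + u * vq) - vn * (u * q)) =
     (Y * w - X * u * q) * (vu * q + u * vq) + u * q * (X * q * vu + (X * u * vq + - Y * vn)) by ring.
  by rewrite E E' subrr mul0r mulr0 addr0.
have coefV k (T : {poly K}) (c : nat -> K) : T = \poly_(l < k) c l -> T = 0 -> forall l : 'I_k, c l = 0.
  by move=> TE T0 l; have := coef_poly k c l; rewrite ltn_ord -TE T0 coef0.
apply/rowP => i; rewrite mxE -[i]splitK; case: (split i) => [k|i'] /=.
  by have := coefV _ _ _ erefl Vu0 k; rewrite valK.
rewrite -[i']splitK; case: (split i') => [k|k] /=.
  by have := coefV _ _ _ erefl Vq0 k; rewrite valK.
by have := coefV _ _ _ erefl Vn0 k; rewrite inord_val.
Qed.

Lemma slp_computes_lift k0 (k : 'I_m1) : (msize (cu k) <= d.+1)%N ->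
  slp_computes [::] k0 (codom a ++ codom b) ->
  slp_computes [::] ((2 * d + 3) * d.+1 * (k0 + ((m1 + (m2 + d.+1)) +
    d * newton_cost (m1 + (m2 + d.+1)) M)) + d.+2) [:: cu k].
Proof.
move=> sz cab.
pose J : 'M[K]_(m1 + (m2 + d.+1), M) := \matrix_(i, j) jacobian L1 L2 L3 lam mu a b zs i j.
(* There may be more equations than unknowns: injectivity on row vectors gives the one-sided inverse
   that the iteration uses. *)
have /row_freeP[S JS] : row_free J.
  apply: inj_row_free => v vJ; apply: jac_inj => j; move/rowP/(_ j): vJ; rewrite !mxE => E.
  by rewrite -[RHS]E; apply: eq_bigr => i _; rewrite mxE.
have zk : zs (lshift _ k) = cu k by rewrite /zs blocks1.
rewrite -zk; apply: (slp_computes_root (S := fun j i => S j i) zs_root) => //; last by rewrite zk.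
move=> i l; move/matrixP/(_ i l): JS; rewrite !mxE => E; rewrite -[RHS]E.
by apply: eq_bigr => j _; rewrite mxE.
Qed.

End Lift.

(** * Translations and specialized lines *)

Section Translate.
Variables (F : comNzRingType) (K : idomainType) (iota : {rmorphism F -> K}) (n : nat).

Definition translate (v : 'I_n -> K) : {mpoly F[n]} -> {mpoly K[n]} :=
  mmap (@mpolyC n K \o iota) (fun i => 'X_i + (v i)%:MP).
HB.instance Definition _ v := GRing.RMorphism.on (translate v).

Lemma translateC v c : translate v c%:MP = (iota c)%:MP.
Proof. by rewrite /translate mmapC. Qed.

Lemma translateX v i : translate v 'X_i = 'X_i + (v i)%:MP.
Proof. by rewrite /translate mmapU. Qed.

Lemma msize_translate v p : (msize (translate v p) <= msize p)%N.
Proof.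
rewrite /translate /mmap big_seq; apply: (big_ind (fun q : {mpoly K[n]} => msize q <= msize p)%N).
- by rewrite msize0.
- by move=> q r sq sr; apply: leq_trans (msizeD_le _ _) _; rewrite geq_max sq.
move=> m mp; apply: leq_trans (msize_mdeg_lt mp).
have mulle (q r : {mpoly K[n]}) k l : (msize q <= k.+1)%N -> (msize r <= l.+1)%N -> (msize (q * r) <= (k + l).+1)%N.
  move=> sq sr; have [->|q0] := eqVneq q 0; first by rewrite mul0r msize0.
  have [->|r0] := eqVneq r 0; first by rewrite mulr0 msize0.
  by rewrite msizeM // -subn1 leq_subLR; apply: leq_trans (leq_add sq sr) _; lia.
rewrite -[mdeg m]add0n; apply: (@mulle _ _); first by rewrite /= msizeC; case: eqP.
rewrite mdegE /mmap1; elim: (index_enum _) => [|i s IH]; first by rewrite !big_nil msize1.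
rewrite !big_cons; apply: (@mulle _ _) => //.
elim: (m i) => [|k IHk]; first by rewrite expr0 msize1.
rewrite exprS; apply: (@mulle _ _ 1 k) => //.
apply: leq_trans (msizeD_le _ _) _; rewrite geq_max msizeX mdeg1 /= msizeC.
by case: eqP.
Qed.

End Translate.

Lemma coprimep_bezout (R : idomainType) (K : fieldType) (ev : {rmorphism R -> K}) (A B S T : {poly R}) c :
  S * A + T * B = c%:P -> ev c != 0 -> coprimep (map_poly ev A) (map_poly ev B).
Proof.
move=> E c0; apply/Bezout_coprimepP; exists (map_poly ev S, map_poly ev T) => /=.
by rewrite -!rmorphM -rmorphD /= E map_polyC /= -size_poly_eq1 size_polyC c0.
Qed.

Section SpecialLine.
Variables (F : fieldType) (K : fieldType) (iota : {rmorphism F -> K}) (n : nat).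
Variables (beta alpha : 'I_n -> K).
Implicit Types x : {mpoly F[n]}.
Local Notation PR := (mpoly_ring K n).

Let jP : {rmorphism F -> PR} := (@mpolyC n K \o iota).
Let A (i : 'I_n) : PR := 'X_i + (beta i)%:MP.
Let B (i : 'I_n) : PR := (alpha i)%:MP.

(* The coefficient of y^k in x('X + beta + alpha y). *)
Definition line_coef x k : {mpoly K[n]} := (line jP A B x)`_k.

Lemma ev0_line_coef x k : ev0 (line_coef x k) = (line iota beta alpha x)`_k.
Proof.
pose e : {rmorphism PR -> K} := @ev0 K n.
have <- : map_poly e (line jP A B x) = line iota beta alpha x.
  rewrite map_line; apply: (@mpoly_rmorph_eq _ _ _ (line _ _ _) (line _ _ _)) => [c|i] /=.
    by rewrite !lineC /= [e _]ev0C.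
  by rewrite !lineX /= [e (B i)]ev0C [e (A i)]ev0D ev0C [ev0 _]mevalXU add0r.
by rewrite coef_map.
Qed.

(** The top coefficient depends on the direction alone, and [alpha] is constant in the variables.
    This yields the scalars [lu] and [lq] of the lifting step. *)
Lemma line_coef_top x k : (msize x <= k.+1)%N ->
  line_coef x k = ((line iota beta alpha x)`_k)%:MP.
Proof.
move=> sx; rewrite /line_coef !coef_line_top //.
by rewrite (rmorph_mmap (@mpolyC n K)).
Qed.

Lemma translate_line x y k : (msize x <= k)%N ->
  translate iota (fun i => beta i + alpha i * y) x = \sum_(l < k) (y ^+ l)%:MP * line_coef x l.
Proof.
move=> sx; have sl := leq_trans (size_line jP A B x) sx.
have E : (line jP A B x).[(y%:MP : {mpoly K[n]})] = translate iota (fun i => beta i + alpha i * y) x.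
  apply: etrans (horner_line _ _ _ _ _) _.
  apply: (@mpoly_rmorph_eq _ _ _ (mmap jP _) (translate iota _)) => [c|i].
    exact (etrans (mmapC _ jP c) (esym (translateC _ _ _))).
  apply: etrans (mmapU jP _ i) (etrans _ (esym (translateX _ _ _))).
  by rewrite mpolyCD mpolyCM addrA.
rewrite -E (horner_coef_wide _ sl); apply: eq_bigr => l _.
by rewrite mulrC; congr (_ * _); exact (esym (rmorphXn (@mpolyC n K) l y)).
Qed.

(** Parameter 0 on the line gives back the whole polynomial up to translation, so this single
    unknown recovers u. *)
Lemma line_coef0 x : line_coef x 0 = translate iota beta x.
Proof.
have -> : translate iota beta x = translate iota (fun i => beta i + alpha i * 0) x.
  apply: eq_mmap => // i; by rewrite mulr0 addr0.
rewrite (translate_line 0 (leqnSn (msize x))) big_ord_recl expr0 mpolyC1 mul1r big1 ?addr0 // => i _.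
by rewrite expr0n mpolyC0 mul0r.
Qed.

Lemma ev0_translate v x : ev0 (translate iota v x) = mmap iota v x.
Proof.
apply: (@mpoly_rmorph_eq _ _ _ (@ev0 K n \o translate iota v) (mmap iota v)) => [c|i] /=.
  by rewrite translateC mmapC ev0C.
by rewrite translateX mmapU ev0D ev0C [ev0 _]mevalXU add0r.
Qed.

End SpecialLine.

(** [3 * k * (2 * d).+1] pays for translating a and b to the sample points, the [newton_cost] term
    for the iteration with at most 2d + 1 unknowns, [(2 * d + 3) * d.+1] for homogeneous components,
    and the outer 3 for translating back and its cost. *)
Definition lift_cost (d k : nat) : nat :=
  (3 * ((2 * d + 3) * d.+1 * (3 * k * (2 * d).+1 +
     ((2 * d).+1 + d * newton_cost (2 * d).+1 (2 * d).+1)) + d.+2))%N.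

Section Factor.
Variables (F : fieldType) (K : closedFieldType) (iota : {rmorphism F -> K}) (n d : nat).
Variables (u q N a b : {mpoly F[n]}).
Hypotheses (eqF : a * (u * q) = N * b) (u0 : u != 0) (q0 : q != 0) (b0 : b != 0).
Hypotheses (su : (1 < msize u)%N) (suq : (msize (u * q) <= d.+1)%N) (sN : (msize N <= d.+1)%N).
Hypothesis cop : forall (R : idomainType) (jR : {rmorphism F -> R}) (base dir : 'I_n -> R),
  generic_line_spec iota jR base dir ->
  [/\ bezout (line jR base dir u) (line jR base dir q),
      bezout (line jR base dir N) (line jR base dir u) &
      bezout (line jR base dir N) (line jR base dir q)].

Let m1 := (msize u).-1.
Let m2 := (msize q).-1.
Let su1 : msize u = m1.+1. Proof. by rewrite prednK // lt0n msize_poly_eq0. Qed.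
Let sq1 : msize q = m2.+1. Proof. by rewrite prednK // lt0n msize_poly_eq0. Qed.
Let m12 : (m1 + m2 <= d)%N.
Proof. by move: suq; rewrite msizeM // su1 sq1; lia. Qed.
Let m1_gt0 : (0 < m1)%N. Proof. by move: su; rewrite su1. Qed.

Lemma special_line_exists : exists beta alpha : 'I_n -> K,
  let L := line iota beta alpha in
  [/\ coprimep (L u) (L q), coprimep (L N) (L u), coprimep (L N) (L q),
      size (L u) = m1.+1 /\ size (L q) = m2.+1 & mmap iota beta b != 0].
Proof.
have [R [jR [base [dir spec]]]] := generic_line_exists iota n.
have [[S1 [T1 [c1 [c10 E1]]]] [S2 [T2 [c2 [c20 E2]]]] [S3 [T3 [c3 [c30 E3]]]]] := cop spec.
have [_ base0 dir0 evs] := spec.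
pose tu := mmap jR dir (top_form m1 u); pose tq := mmap jR dir (top_form m2 q).
pose tb := mmap jR base b.
(* One evaluation serves all conditions: [c1], [c2], [c3] preserve coprimality, [tu] and [tq] the
   degrees along the line, [tb] the value of [b] at the base point. *)
have [|ev [evc evj]] := evs (c1 * c2 * c3 * (tu * tq * tb)).
  by rewrite !mulf_neq0 // ?base0 // dir0 // top_form_neq0.
move: evc; rewrite !rmorphM !mulf_eq0 !negb_or.
case/andP=> /andP[/andP[ev1 ev2] ev3] /andP[/andP[evu evq] evb].
have lineE x : map_poly ev (line jR base dir x) = line iota (ev \o base) (ev \o dir) x.
  rewrite map_line; apply: (@mpoly_rmorph_eq _ _ _ (line _ _ _) (line _ _ _)) => [c|i] /=.
    by rewrite !lineC; congr (_%:P); apply: evj.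
  by rewrite !lineX.
have mmapE h x : ev (mmap jR h x) = mmap iota (ev \o h) x.
  by rewrite rmorph_mmap; apply: eq_mmap.
have sizeE x k : msize x = k.+1 -> ev (mmap jR dir (top_form k x)) != 0 ->
    size (line iota (ev \o base) (ev \o dir) x) = k.+1.
  move=> sx nz; apply/eqP; rewrite eqn_leq -{1}sx size_line /= ltnNge; apply/negP => sl.
  move: nz; rewrite mmapE -(coef_line_top _ (ev \o base)) ?sx //.
  by rewrite nth_default ?eqxx.
exists (ev \o base), (ev \o dir); rewrite /= -!lineE; split.
- exact: coprimep_bezout E1 ev1.
- exact: coprimep_bezout E2 ev2.
- exact: coprimep_bezout E3 ev3.
- by rewrite !lineE; split; apply: sizeE.
- by rewrite -mmapE.
Qed.

Lemma slp_computes_factor ka kb : slp_computes [::] ka [:: a] -> slp_computes [::] kb [:: b] ->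
  slp_computes [::] (lift_cost d (ka + kb)) [:: map_mpoly iota u].
Proof.
move=> ca cb; have [beta [alpha [cUQ cNU cNQ [sU sQ] bb]]] := special_line_exists.
have Lb0 : line iota beta alpha b != 0.
  apply: contraNneq bb => Lb0; have := horner_line iota beta alpha b 0.
  rewrite Lb0 horner0 => ->; apply/eqP; apply: eq_mmap => // i.
  by rewrite mulr0 addr0.
have [y [yI yb]] := poly_nonroots (2 * d).+1 Lb0.
pose v j i := beta i + alpha i * y j.
have lc x k j : msize x = k.+1 -> translate iota (v j) x =
    ((line iota beta alpha x)`_k * y j ^+ k)%:MP +
    \sum_(l < k) (y j ^+ l)%:MP * line_coef iota beta alpha x l.
  move=> sx; rewrite (@translate_line _ _ iota _ beta alpha x (y j) k.+1) ?sx //.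
  by rewrite big_ord_recr /= addrC line_coef_top ?sx // -mpolyCM mulrC.
(* As [u] is nonconstant, its coefficient of index 0 is an unknown and not the fixed leading one. *)
have ord0m : (0 < m1)%N by [].
have cvec x k : slp_computes [::] k [:: x] ->
    slp_computes [::] (3 * k * (2 * d).+1) (codom (fun j => translate iota (v j) x)).
  by move=> cx; apply: slp_computes_fam => j; apply: slp_computes_translate.
have main := @slp_computes_lift K n d m1 m2
  (fun k => line_coef iota beta alpha u k) (fun k => line_coef iota beta alpha q k)
  (fun k => line_coef iota beta alpha N k)
  (line iota beta alpha u)`_m1 (line iota beta alpha q)`_m2 y
  (fun j => translate iota (v j) a) (fun j => translate iota (v j) b)
  (line iota beta alpha u) (line iota beta alpha q) (line iota beta alpha N).
have c0 : slp_computes [::] ((2 * d + 3) * d.+1 * ((3 * ka * (2 * d).+1 + 3 * kb * (2 * d).+1) +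
    ((m1 + (m2 + d.+1)) + d * newton_cost (m1 + (m2 + d.+1)) (2 * d).+1)) + d.+2)
    [:: line_coef iota beta alpha u (Ordinal ord0m)].
  apply: main => //.
  - move=> j; rewrite -(lc _ _ _ su1) -(lc _ _ _ sq1) -(translate_line iota beta alpha (y j) sN).
    by rewrite -!rmorphM -mulrA eqF mulrC rmorphM.
  - exact: leq_trans (size_line _ _ _ _) sN.
  - by move=> k; rewrite ev0_line_coef.
  - by move=> k; rewrite ev0_line_coef.
  - by move=> k; rewrite ev0_line_coef.
  - by move=> j; rewrite ev0_translate; have := yb j; rewrite horner_line.
  - rewrite /= line_coef0; apply: leq_trans (msize_translate _ _ _) _.
    by rewrite su1 ltnS; apply: leq_trans m12; rewrite leq_addr.
  - by apply: slp_computes_cat; apply: cvec.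
rewrite /= line_coef0 in c0.
(* The coefficient found is [u] translated by [beta]; translating by [- beta] undoes this. *)
have := slp_computes_translate idfun (fun i => - beta i) c0.
have -> : mmap (@mpolyC n K \o idfun) (fun i => 'X_i + (- beta i)%:MP) (translate iota beta u) = map_mpoly iota u.
  apply: (@mpoly_rmorph_eq _ _ _ (mmap (@mpolyC n K \o idfun) _ \o translate iota beta) (map_mpoly iota)) => [c|i] /=.
    by rewrite translateC mmapC map_mpolyC.
  by rewrite translateX rmorphD /= mmapU mmapC map_mpolyX /= mpolyCN subrK.
apply: slp_computes_leq; rewrite /lift_cost leq_mul2l /= leq_add2r leq_mul2l; apply/orP; right.
apply: leq_add; first by rewrite mulnDr mulnDl.
have mm : (m1 + (m2 + d.+1) <= (2 * d).+1)%N by rewrite addnA mul2n -addnn -addnS leq_add2r.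
by apply: leq_add => //; rewrite leq_mul2l /newton_cost leq_add ?orbT // leq_mul // leq_add // leq_mul.
Qed.

End Factor.

(** * Logarithmic derivatives *)

Lemma derivationX (R : comNzRingType) (D : R -> R) a k : derivation D ->
  D (a ^+ k) * a = k%:R * a ^+ k * D a.
Proof.
move=> dD; have [_ DM] := dD; elim: k => [|k IH].
  by rewrite expr0 (derivation1 dD) !mul0r.
have -> : D (a ^+ k.+1) * a = D a * a ^+ k * a + a * (D (a ^+ k) * a).
  by rewrite exprS DM mulrDl mulrA.
rewrite IH -natr1 exprS; move: (k%:R) (a ^+ k) (D a) => x z w; ring.
Qed.

Section LogDerivative.
Variables (F : fieldType) (n p : nat) (D : {mpoly F[n]} -> {mpoly F[n]}).
Hypotheses (charF : p \in [pchar F]) (degD : degree_derivation D).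
Implicit Types (us : seq ({mpoly F[n]} * nat)).

(** These factors form the denominator of the logarithmic derivative. A factor u whose exponent p
    divides contributes zero; one that divides D u contributes a constant. *)
Definition visible (ue : {mpoly F[n]} * nat) : bool :=
  ~~ (p %| ue.2)%N && `[< ~ rdvd ue.1 (D ue.1) >].

Definition indep (x y : {mpoly F[n]} * nat) : bool :=
  `[< ~ rdvd x.1 y.1 /\ ~ rdvd y.1 x.1 >].

Lemma msizeM_mono (a b a' b' : {mpoly F[n]}) : a' != 0 -> b' != 0 ->
  (msize a <= msize a')%N -> (msize b <= msize b')%N -> (msize (a * b) <= msize (a' * b'))%N.
Proof.
move=> a'0 b'0 sa sb; have [->|a0] := eqVneq a 0; first by rewrite mul0r msize0.
have [->|b0] := eqVneq b 0; first by rewrite mulr0 msize0.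
by rewrite !msizeM // -!subn1 leq_sub2r // leq_add.
Qed.

Lemma msizeD_mono k (a b : {mpoly F[n]}) : (msize a <= k)%N -> (msize b <= k)%N -> (msize (a + b) <= k)%N.
Proof. by move=> sa sb; apply: leq_trans (msizeD_le _ _) _; rewrite geq_max sa. Qed.

Lemma msizeMnr_le k (a : {mpoly F[n]}) l : (msize a <= k)%N -> (msize (l%:R * a) <= k)%N.
Proof.
move=> sa; rewrite -mpolyC_nat mul_mpolyC; apply: leq_trans (msizeZ_le _ _) sa.
Qed.

Lemma log_derivative us : (forall x, x \in us -> rprime x.1) -> pairwise indep us ->
  let q := \prod_(x <- us | visible x) x.1 in
  exists N, [/\ D (\prod_(x <- us) x.1 ^+ x.2) * q = N * \prod_(x <- us) x.1 ^+ x.2,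
    (msize N <= msize q)%N & forall x, x \in us -> visible x -> ~ rdvd x.1 N].
Proof.
have [dD _ _ Ds] := degD; have [DD DM] := dD.
elim: us => [|[u e] us IH] /= pr.
  by move=> _; exists 0; split=> //; rewrite !big_nil ?(derivation1 dD) ?mul0r // msize0.
case/andP=> /allP indu /IH[|N' [E sN nd]]; first by move=> x xs; apply: pr; rewrite inE xs orbT.
have pu : rprime u by apply: (pr (u, e)); rewrite mem_head.
have [u0 _ pu'] := pu.
have prs x : x \in us -> rprime x.1 by move=> xs; apply: pr; rewrite inE xs orbT.
have ind x : x \in us -> ~ rdvd u x.1 /\ ~ rdvd x.1 u by move/indu/asboolP.
rewrite !big_cons /=; set q := \prod_(x <- us | visible x) x.1 in E sN *.
set P := \prod_(x <- us) x.1 ^+ x.2 in E *.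
have q0 : q != 0 by rewrite prodf_seq_neq0; apply/allP => x /prs[x0 _ _]; apply/implyP.
have dvdq x : x \in us -> visible x -> rdvd x.1 q.
  by move=> xs vx; exists (\prod_(z <- rem x us | visible z) z.1); rewrite /q (perm_big _ (perm_to_rem xs)) big_cons vx.
have nduq : ~ rdvd u q.
  rewrite /q -big_filter => h.
  have [|z] := @rprime_dvd_prod _ u [seq x.1 | x <- us & visible x] pu; first by rewrite big_map.
  by case/mapP=> x; rewrite mem_filter => /andP[_ /ind[nux _]] ->.
have DX := derivationX u e dD.
have [pe|npe] := boolP (p %| e)%N.
  have -> : visible (u, e) = false by rewrite /visible /= pe.
  have Due : D (u ^+ e) = 0.
    have e0 : e%:R = 0 :> {mpoly F[n]}.
      have eF : e%:R = 0 :> F by apply/eqP; rewrite -(dvdn_pcharf charF).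
      by rewrite -mpolyC_nat eF mpolyC0.
    by move/eqP: DX; rewrite e0 !mul0r mulf_eq0 (negbTE u0) orbF => /eqP.
  exists N'; split=> //.
    by rewrite DM Due mul0r add0r -mulrA E mulrCA.
  move=> x; rewrite inE => /orP[/eqP->|xs] vx; last exact: nd.
  by move: vx; rewrite /visible /= pe.
have [ndu|] := asboolP (~ rdvd u (D u)).
  have -> : visible (u, e) = true by rewrite /visible /= npe; apply/asboolP.
  exists (e%:R * (D u * q) + u * N'); split.
  - have -> : D (u ^+ e * P) * (u * q) = D (u ^+ e) * u * (P * q) + u ^+ e * u * (D P * q).
      rewrite DM; move: (D (u ^+ e)) (D P) (u ^+ e) => x1 x2 x3; ring.
    by rewrite DX E; move: (D u) (u ^+ e) (e%:R) => x1 x2 x3; ring.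
  - apply: msizeD_mono; last by apply: msizeM_mono.
    by apply: msizeMnr_le; apply: msizeM_mono.
  - have ne : e%:R != 0 :> F by rewrite -(dvdn_pcharf charF).
    move=> x; rewrite inE => /orP[/eqP-> _|xs vx] /= h.
      have : rdvd u (e%:R * (D u * q)).
        rewrite -[_ * _](addrK (u * N')); apply: rdvdB h _.
        by apply: rdvd_mulr; apply: rdvd_refl.
      case/pu' => [[w Ew]|/pu'[]//].
      have ue : (e%:R : {mpoly F[n]}) \is a GRing.unit.
        by rewrite -mpolyC_nat; apply: rmorph_unit; rewrite unitfE.
      have uu : u \is a GRing.unit by apply: rdvd_unit ue; exists w.
      by case: pu => _; rewrite uu.
    have : rdvd x.1 (u * N').
      rewrite -[u * N'](addKr (e%:R * (D u * q))) addrC; apply: rdvdB => //.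
      by do 2!apply: rdvd_mull; apply: dvdq.
    have [_ _ px] := prs _ xs; case/px => [xu|]; last exact: nd.
    by have [_ []] := ind _ xs.
move/contrapT => [k kE].
have -> : visible (u, e) = false.
  by rewrite /visible /= npe /=; apply/asboolP => h; apply: h; exists k.
have Due : D (u ^+ e) = e%:R * u ^+ e * k.
  by apply: (mulIf u0); rewrite DX kE [u * k]mulrC mulrA.
(* Since [D] does not raise degrees, the quotient of D u by u is constant, and this factor only adds
   a multiple of [q] to the numerator. *)
have sk : (msize k <= 1)%N.
  have [->|k0] := eqVneq k 0; first by rewrite msize0.
  by have := Ds u; rewrite kE msizeM //; apply: predD_leq; rewrite msize_poly_eq0.
exists (e%:R * (k * q) + N'); split.
- rewrite DM Due; have -> : (e%:R * u ^+ e * k * P + u ^+ e * D P) * q = e%:R * u ^+ e * k * P * q + u ^+ e * (D P * q).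
    move: (D P) (u ^+ e) (e%:R) => x1 x2 x3; ring.
  by rewrite E; move: (u ^+ e) (e%:R) => x2 x3; ring.
- apply: msizeD_mono => //; apply: msizeMnr_le; rewrite -[q in (_ <= msize q)%N]mul1r.
  by apply: msizeM_mono; rewrite ?oner_eq0 ?msize1.
- move=> x; rewrite inE => /orP[/eqP-> vx|xs vx] /= h.
    by case/andP: vx => _ /asboolP[]; exists k.
  apply: (nd x xs vx); rewrite -[N'](addKr (e%:R * (k * q))) addrC; apply: rdvdB => //.
  by do 2!apply: rdvd_mull; apply: dvdq.
Qed.

End LogDerivative.

(** Each prime of the product goes either to [g] or to its cofactor. The size bound later limits the
    number of factors of [g]. *)
Lemma rdvd_prod_primes (R : idomainType) (s : seq R) g : (forall x, x \in s -> rprime x) ->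
  rdvd g (\prod_(x <- s) x) ->
  exists c s', [/\ c \is a GRing.unit, {subset s' <= s}, (size s' <= size s)%N & g = c * \prod_(x <- s') x].
Proof.
elim: s g => [|x s IH] g pr.
  rewrite big_nil => /rdvd_unit /(_ (unitr1 _)) ug.
  by exists g, [::]; split=> //; rewrite big_nil mulr1.
have px : rprime x by apply: pr; rewrite mem_head.
have prs z : z \in s -> rprime z by move=> zs; apply: pr; rewrite inE zs orbT.
have [x0 _ px'] := px; rewrite big_cons => -[h E].
case: (px' g h) => [|[g' gE]|[h' hE]].
- by rewrite -E; apply: rdvd_mulr; apply: rdvd_refl.
- have [|c [s' [uc sub sz g'E]]] := IH g' prs.
    by exists h; apply: (mulfI x0); rewrite E gE mulrA.
  exists c, (x :: s'); split=> //; last by rewrite gE g'E big_cons mulrCA.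
  by move=> z; rewrite !inE => /orP[->//|/sub->]; rewrite orbT.
- have [|c [s' [uc sub sz gE]]] := IH g prs.
    by exists h'; apply: (mulfI x0); rewrite E hE mulrCA.
  exists c, s'; split=> //; last exact: leqW.
  by move=> z /sub zs; rewrite inE zs orbT.
Qed.

Section MpolyUnits.
Variables (F : fieldType) (n : nat).
Implicit Types (c u : {mpoly F[n]}).

Lemma mpoly_unit_const c : c \is a GRing.unit -> c = (c@_0)%:MP.
Proof.
move=> uc; apply: msize1_polyC; have c0 : c != 0 by apply: contraTneq uc => ->; rewrite unitr0.
by apply: leq_trans (msize_rdvd (oner_neq0 _) (unit_rdvd 1 uc)) _; rewrite msize1.
Qed.

Lemma msize_rprime u : rprime u -> (1 < msize u)%N.
Proof.
move=> [u0 uu _]; rewrite ltnNge; apply: contra uu => /msize1_polyC uE.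
rewrite uE; apply: rmorph_unit; rewrite unitfE; apply: contraNneq u0 => E.
by rewrite uE E mpolyC0.
Qed.

Lemma size_prod_primes (s : seq {mpoly F[n]}) : (forall x, x \in s -> rprime x) ->
  (size s < msize (\prod_(x <- s) x))%N.
Proof.
elim: s => [|x s IH] pr; first by rewrite big_nil msize1.
have prs z : z \in s -> rprime z by move=> zs; apply: pr; rewrite inE zs orbT.
have px : rprime x by apply: pr; rewrite mem_head.
have P0 : \prod_(x <- s) x != 0.
  by rewrite prodf_seq_neq0; apply/allP => z /prs[z0 _ _]; apply/implyP.
rewrite big_cons msizeM //; last by case: px.
rewrite -subn1 ltn_subRL; exact (leq_add (msize_rprime px) (IH prs)).
Qed.

End MpolyUnits.

(** * Polynomial bounds and assembly of the factors *)

Definition poly_bounded (f : nat -> nat) : Prop := exists B : {poly nat}, forall t, B.[t] = f t.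

Lemma poly_bounded_const c : poly_bounded (fun=> c).
Proof. by exists c%:P => t; rewrite hornerC. Qed.

Lemma poly_bounded_id : poly_bounded id.
Proof. by exists 'X => t; rewrite hornerX. Qed.

Lemma poly_boundedD f g : poly_bounded f -> poly_bounded g -> poly_bounded (fun t => f t + g t)%N.
Proof. by move=> [B Bf] [C Cg]; exists (B + C) => t; rewrite hornerD Bf Cg. Qed.

Lemma poly_boundedM f g : poly_bounded f -> poly_bounded g -> poly_bounded (fun t => f t * g t)%N.
Proof. by move=> [B Bf] [C Cg]; exists (B * C) => t; rewrite hornerM Bf Cg. Qed.

Lemma poly_boundedS f : poly_bounded f -> poly_bounded (fun t => (f t).+1).
Proof.
move=> pf; have [B BE] := poly_boundedD pf (poly_bounded_const 1).
by exists B => t; rewrite BE addn1.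
Qed.

Section PrimeFactor.
Variables (F : fieldType) (p : nat) (K : closedFieldType) (iota : {rmorphism F -> K}) (n : nat).
Variables (f u0 u1 : {mpoly F[n]}) (s : nat) (c : F) (us : seq ({mpoly F[n]} * nat)).
Hypotheses (charF : p \in [pchar F]) (f0 : f != 0) (u00 : u0 != 0) (fE : f = u0 * u1)
  (sz : (poly_size f + poly_size u0 <= s)%N).
Hypotheses (c0 : c != 0) (pr : forall x, x \in us -> rprime x.1) (ind : pairwise (@indep F n) us)
  (u1E : u1 = c *: \prod_(x <- us) x.1 ^+ x.2).

Let r := \prod_(x <- us | ~~ (p %| x.2)%N) x.1.

Lemma bezout_prod (R : idomainType) (jR : {rmorphism F -> R}) (base dir : 'I_n -> R)
    (A : {poly R}) (l : seq ({mpoly F[n]} * nat)) (P : pred ({mpoly F[n]} * nat)) :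
  (forall x, x \in l -> P x -> bezout A (line jR base dir x.1)) ->
  bezout A (line jR base dir (\prod_(x <- l | P x) x.1)).
Proof.
elim: l => [|x l IH] H; first by rewrite big_nil rmorph1; apply: bezout1.
have IH' : bezout A (line jR base dir (\prod_(x <- l | P x) x.1)).
  by apply: IH => z zl; apply: H; rewrite inE zl orbT.
rewrite big_cons; case: ifP => // Px; rewrite rmorphM; apply: bezoutM => //.
by apply: H => //; rewrite mem_head.
Qed.

Lemma slp_computes_prime_factor ue : ue \in us -> ~~ (p %| ue.2)%N ->
  slp_computes [::] (lift_cost (total_degree r) (8 * s + 6)) [:: map_mpoly iota ue.1].
Proof.
move=> uein pe; have pu := pr uein.
have [D degD nD] := prime_degree_derivation charF pu.
have vis : visible p D ue by rewrite /visible pe; apply/asboolP.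
have [N [EN sN nN]] := log_derivative charF degD pr ind.
set P := \prod_(x <- us) x.1 ^+ x.2 in EN; have u1P : u1 = c *: P := u1E.
set q := \prod_(x <- us | visible p D x) x.1 in EN sN.
have [dD _ _ _] := degD; have [DD DM] := dD.
have prod0 (Q : pred ({mpoly F[n]} * nat)) : \prod_(x <- us | Q x) x.1 != 0.
  by rewrite prodf_seq_neq0; apply/allP => x /pr[x0 _ _]; apply/implyP.
have [c' Dc] : exists c', D c%:MP = c'%:MP by case: degD.
(* [D] may act on coefficients, so the scalar [c] contributes its own logarithmic derivative
   [c' / c]. Being a multiple of [q], the correction does not affect divisibility by visible
   factors. *)
pose N1 := N + (c' / c)%:MP * q.
have EN1 : D u1 * q = N1 * u1.
  rewrite u1P -mul_mpolyC DM Dc mulrDl -[c%:MP * D P * q]mulrA EN /N1.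
  have -> : c'%:MP = (c' / c)%:MP * c%:MP :> {mpoly F[n]} by rewrite -mpolyCM divfK.
  by move: (c%:MP) ((c' / c)%:MP) => x y; ring.
have sN1 : (msize N1 <= msize q)%N.
  apply: msizeD_mono => //; rewrite mul_mpolyC; exact: msizeZ_le.
have nN1 x : x \in us -> visible p D x -> ~ rdvd x.1 N1.
  move=> xs vx h; apply: (nN x xs vx); rewrite -[N](addrK ((c' / c)%:MP * q)); apply: rdvdB => //.
  apply: rdvd_mull; exists (\prod_(z <- rem x us | visible p D z) z.1).
  by rewrite /q (perm_big _ (perm_to_rem xs)) big_cons vx.
have r0 : r != 0 by apply: prod0.
have sr : msize r = (total_degree r).+1 by rewrite /total_degree prednK // lt0n msize_poly_eq0.
have sqr : (msize q <= (total_degree r).+1)%N.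
  rewrite -sr; apply: msize_rdvd => //; exists (\prod_(x <- us | ~~ (p %| x.2)%N && ~~ `[< ~ rdvd x.1 (D x.1) >]) x.1).
  by rewrite /r (bigID (fun x => `[< ~ rdvd x.1 (D x.1) >])).
(* a / b is D f / f - D u0 / u0 over a common denominator, computed from [f] and [u0] alone. *)
pose a := u0 * D f - f * D u0; pose b := f * u0.
have aq : a * q = N1 * b.
  rewrite /a /b fE DM.
  have -> : (u0 * (D u0 * u1 + u0 * D u1) - u0 * u1 * D u0) * q = u0 * u0 * (D u1 * q).
    by move: (D u0) (D u1) => x y; ring.
  by rewrite EN1; ring.
have [l1 [l2 usE]] : exists l1 l2, us = l1 ++ ue :: l2.
  by case/splitPr: uein => l1 l2; exists l1, l2.
pose q' := \prod_(x <- l1 | visible p D x) x.1 * \prod_(x <- l2 | visible p D x) x.1.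
have qE : q = ue.1 * q'.
  by rewrite /q usE big_cat big_cons vis /= mulrCA.
have N10 : N1 != 0.
  by apply/eqP => N10; case: (nN1 ue uein vis); rewrite N10; exists 0; rewrite mulr0.
have indu x : (x \in l1) || (x \in l2) -> ~ rdvd ue.1 x.1.
  have := ind; rewrite usE pairwise_cat pairwise_cons allrel_consr -!andbA.
  case/and5P=> /allP h1 _ _ /allP h2 _ /orP[/h1|/h2] /asboolP[] //.
have sub x : (x \in l1) || (x \in l2) -> x \in us.
  by rewrite usE mem_cat inE => /orP[->|->]; rewrite ?orbT.
have [u0' _ _] := pu.
have q0 : q != 0 by apply: prod0.
have q'0 : q' != 0 by apply: contraNneq q0 => E; rewrite qE E mulr0.
have cf := slp_computes_derivation degD (slp_computes_of_poly_size f).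
have cu := slp_computes_derivation degD (slp_computes_of_poly_size u0).
have cfu : slp_computes [::] (4 * s) [:: f; D f; u0; D u0].
  apply: slp_computes_leq (slp_computes_cat cf cu).
  by rewrite -mulnDr leq_mul2l.
have mem (x : {mpoly F[n]}) : x \in [:: f; D f; u0; D u0] -> slp_computes ([:: f; D f; u0; D u0] ++ [::]) 0 [:: x].
  exact: slp_computes_in.
have ca : slp_computes [::] (4 * s + 5) [:: a].
  apply: slp_computes_bind cfu _; apply: (@slp_computesB _ _ _ 1 1);
    apply: (@slp_computesM _ _ _ 0 0); apply: mem; rewrite !inE eqxx ?orbT //.
have cb : slp_computes [::] (4 * s + 1) [:: b].
  apply: slp_computes_bind cfu _;
    apply: (@slp_computesM _ _ _ 0 0); apply: mem; rewrite !inE eqxx ?orbT //.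
(* [f], [u0] and their derivatives take at most 4s steps; [a] takes 5 more and [b] one. *)
have -> : (8 * s + 6 = (4 * s + 5) + (4 * s + 1))%N by rewrite addnACA -mulnDl.
apply: (@slp_computes_factor F K iota n _ ue.1 q' N1 a b) => //.
- by rewrite -qE.
- by rewrite /b mulf_neq0.
- exact: msize_rprime.
- by rewrite -qE.
- exact: leq_trans sN1 sqr.
move=> R jR base dir [cop _ _ _].
have copN x : x \in us -> visible p D x -> bezout (line jR base dir N1) (line jR base dir x.1).
  by move=> xs vx; apply/bezoutC/cop => //; [apply: pr|apply: nN1].
split.
- rewrite /q' rmorphM; apply: bezoutM; apply: bezout_prod => x xl _; apply: cop => //.
  + by have [] := pr (sub x _); rewrite ?xl.
  + by apply: indu; rewrite xl.
  + by have [] := pr (sub x _); rewrite ?xl ?orbT.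
  + by apply: indu; rewrite xl orbT.
- exact: copN.
- rewrite /q' rmorphM; apply: bezoutM; apply: bezout_prod => x xl vx; apply: copN => //; apply: sub; rewrite xl ?orbT //.
Qed.

End PrimeFactor.

Lemma lift_cost_mono d d' k k' : (d <= d')%N -> (k <= k')%N -> (lift_cost d k <= lift_cost d' k')%N.
Proof.
move=> dd kk; rewrite /lift_cost /newton_cost.
have dd2 : (2 * d <= 2 * d')%N by rewrite leq_mul2l.
by repeat (apply: leq_add || apply: leq_mul || rewrite ltnS).
Qed.

(** The final cost: at most t prime factors at [lift_cost] each, their product with a scalar, and
    the factor 3 from programs to circuits. *)
Lemma lift_cost_poly_bounded : poly_bounded (fun t => 3 * ((lift_cost t (8 * t + 6)).+1 * t + 4))%N.
Proof.
rewrite /lift_cost /newton_cost.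
by repeat (apply: poly_boundedD || apply: poly_boundedM || apply: poly_boundedS ||
  apply: poly_bounded_const || apply: poly_bounded_id).
Qed.

Theorem theorem5p6 :
  exists B : {poly nat},
  forall (F : fieldType) (p : nat) (K : closedFieldType)
    (iota : {rmorphism F -> K}) (n : nat) (f u0 u1 : {mpoly F[n]}) (s : nat),
    p \in [pchar F] ->
    is_algebraic_closure iota ->
    f != 0 -> u0 != 0 -> u1 != 0 ->
    f = u0 * u1 ->
    (poly_size f + poly_size u0 <= s)%N ->
    forall r g : {mpoly F[n]},
      is_partial_radical p u1 r ->
      mdivides g r ->
      exists C : circuit K n,
        computes C (map_mpoly iota g) /\
        (circuit_size C <= B.[(s + total_degree r)%N])%N.
Proof.
have [B BE] := lift_cost_poly_bounded; exists B.
move=> F p K iota n f u0 u1 s charF _ f0 u00 _ fE sz r g [c [us [[c0 irr cop u1E] rE]]] gr.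
rewrite BE; set t := (s + total_degree r)%N.
have facA : factorial_ring {mpoly F[n]} by apply: factorial_mpoly; apply: factorial_field.
have pr x : x \in us -> rprime x.1.
  by case/irr=> -[x0 xu xirr] _; apply: factorial_irreducible_prime.
(* If one prime divided the other, it would be a common divisor of a coprime pair and hence a
   unit. *)
have ind : pairwise (@indep F n) us.
  apply/(pairwiseP (0, 0%N)) => i j iu ju ij.
  have [_ nui _] := pr _ (mem_nth (0, 0%N) iu); have [_ nuj _] := pr _ (mem_nth (0, 0%N) ju).
  have {}ju : (j < size us)%N := ju.
  have cij : mcoprime (nth (0, 0%N) us i).1 (nth (0, 0%N) us j).1 by apply: cop; rewrite ij ju.
  by apply/asboolP; split=> h; [case/negP: nui|case/negP: nuj]; apply: cij => //; apply: rdvd_refl.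
pose ps := [seq x.1 | x <- us & ~~ (p %| x.2)%N].
have rE' : r = \prod_(x <- ps) x by rewrite rE big_map big_filter.
have prs x : x \in ps -> rprime x by case/mapP=> z; rewrite mem_filter => /andP[_ /pr pz] ->.
have [e [s' [ue sub szs gE]]] : exists e s', [/\ e \is a GRing.unit, {subset s' <= ps},
    (size s' <= size ps)%N & g = e * \prod_(x <- s') x].
  by apply: rdvd_prod_primes => //; rewrite -rE'.
have sps : (size s' <= t)%N.
  have := size_prod_primes prs; rewrite -rE' => h.
  apply: leq_trans szs (leq_trans _ (leq_addl _ _)); rewrite /total_degree.
  by case: (msize r) h.
have cx x : x \in s' -> slp_computes [::] (lift_cost t (8 * t + 6)) [:: map_mpoly iota x].
  move/sub/mapP=> [z]; rewrite mem_filter => /andP[pz zu] ->.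
  apply: slp_computes_leq (slp_computes_prime_factor iota charF f0 u00 fE sz c0 pr ind u1E zu pz).
  rewrite -rE; apply: lift_cost_mono; first exact: leq_addl.
  by rewrite leq_add2r leq_mul2l leq_addr.
have cg : slp_computes [::] ((lift_cost t (8 * t + 6)).+1 * t + 4) [:: map_mpoly iota g].
  rewrite gE (mpoly_unit_const ue) rmorphM /= map_mpolyC rmorph_prod.
  apply: slp_computes_leq (slp_computesM (slp_computes_const _ _) (slp_computes_prod cx)).
  by rewrite add1n addn4 !ltnS; apply: leqW; rewrite leq_mul2l sps orbT.
have [C [CC Cs]] := circuit_of_slp_computes cg.
by exists C.
Qed.
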